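(* Let $\mathcal{H}$ be a complex Hilbert space, let $A\in\mathcal{B}(\mathcal{H})$ be a positive operator such that $mI\le A\le MI$ for some scalars $0<m<M$, and let $\Phi$ be a normalized positive linear map on $\mathcal{B}(\mathcal{H})$. (i) If $f$ is an operator monotone function on $(0,\infty)$, then \[ \begin{aligned} f\left(\frac{M+m}{2Mm}\right)&\ge f\left(\frac{\frac{1}{Mm}\Phi(A)+\Phi(A^{-1})}{2}\right)\\ &\ge \frac{f\left(\frac{1}{Mm}\Phi(A)\right)+f\left(\Phi(A^{-1})\right)}{2}\\ &\ge f\left(\frac{1}{Mm}\Phi(A)\right)\sharp\, f\left(\Phi(A^{-1})\right). \end{aligned} \] (ii) If $g$ is an operator monotone decreasing function on $(0,\infty)$, then \[ \begin{aligned} g\left(\frac{M+m}{2Mm}\right)&\le g\left(\frac{\frac{1}{Mm}\Phi(A)+\Phi(A^{-1})}{2}\right)\\ &\le \left\{\frac{g\left(\frac{1}{Mm}\Phi(A)\right)^{-1}+g\left(\Phi(A^{-1})\right)^{-1}}{2}\right\}^{-1}\\ &\le g\left(\frac{1}{Mm}\Phi(A)\right)\sharp\, g\left(\Phi(A^{-1})\right). \end{aligned} \]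
   Context: $\mathcal{B}(\mathcal{H})$ is the algebra of bounded linear operators on $\mathcal{H}$, with identity $I$. $A\ge 0$ (positive) means $\langle Ax,x\rangle\ge 0$ for all $x\in\mathcal{H}$; strictly positive means positive and invertible; $B\ge A$ means $B-A\ge 0$. A scalar in an operator inequality stands for that multiple of $I$. A map $\Phi$ on $\mathcal{B}(\mathcal{H})$ is positive if $\Phi(A)\ge 0$ whenever $A\ge 0$, and normalized if $\Phi(I)=I$. For strictly positive $A,B$, the geometric mean is $A\sharp B=A^{1/2}(A^{-1/2}BA^{-1/2})^{1/2}A^{1/2}$. A continuous real valued function $f$ on $(0,\infty)$ is operator monotone (resp. operator monotone decreasing) if $B\ge A$ implies $f(B)\ge f(A)$ (resp. $f(B)\le f(A)$) for all self-adjoint operators $A,B$ with spectra in $(0,\infty)$. The notation $g(X)^{-1}$ means the operator inverse of $g(X)$.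
   Formalization: The second inequality of (ii) is proved for g > 0 on (0,∞), since it fails for g(t) = 1 − t with H = C, Φ = id, m = 2, M = 4, A = 2; the inequalities with ♯ are stated when both of its operands are strictly positive. *)

(* Defs.v *)
From HB Require Import structures.
From mathcomp Require Import all_boot all_order all_algebra.
From mathcomp Require Import all_classical all_reals.
From mathcomp Require Import topology normedtype.
From mathcomp Require Import sesquilinear complex.

Set Implicit Arguments.
Unset Strict Implicit.
Unset Printing Implicit Defensive.

Import Order.TTheory GRing.Theory Num.Theory Num.Def numFieldNormedType.Exports.

Local Open Scope classical_set_scope.
Local Open Scope ring_scope.
Local Open Scope complex_scope.

Reserved Notation "''B' ( H )" (format "''B' ( H )").
Reserved Notation "A ⪯ B" (at level 70, no associativity).

(* The inner product is linear in its first argument. The norm of [H], like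
   every norm over [R[i]], is valued in [R[i]]. *)
HB.mixin Record CompleteNormedModule_isHilbert (R : realType) (H : Type)
    of CompleteNormedModule R[i] H := {
  hdot : {dot H for conjC} ;
  hdot_norm : forall x : H, `|x| ^+ 2 = hdot x x
}.

#[short(type="hilbertType")]
HB.structure Definition Hilbert (R : realType) :=
  { H of CompleteNormedModule R[i] H & CompleteNormedModule_isHilbert R H }.

Section BoundedOperators.
Context {R : realType} (H : hilbertType R).

Definition bounded_linear_op (T : H -> H) : Prop :=
  linear T /\ exists k : R, forall x, `|T x| <= k%:C * `|x|.

Definition bounded_linear_pred : {pred H -> H} :=
  mem [set T : H -> H | bounded_linear_op T].

Record bop := Bop { bop_fun :> H -> H ; _ : bop_fun \in bounded_linear_pred }.

HB.instance Definition _ := [isSub for bop_fun].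
HB.instance Definition _ := [Choice of bop by <:].

Lemma bopP (T : bop) : bounded_linear_op T.
Proof. by case: T => T /= /set_mem. Qed.

Lemma bop_eqP (A B : bop) : (forall x, A x = B x) -> A = B.
Proof. by move=> AB; apply: val_inj; apply: funext. Qed.

Fact bounded_linear_submod : submod_closed bounded_linear_pred.
Proof.
split.
  apply/mem_set; split; first by move=> a x y; rewrite scaler0 addr0.
  by exists 0 => x; rewrite normr0 mul0r.
move=> a S T /set_mem [linS [s hs]] /set_mem [linT [t ht]].
apply/mem_set; split.
  move=> b x y /=; rewrite !fctE linS linT.
  by rewrite !scalerDr !scalerA addrACA mulrC.
have [k ak] : exists k : R, `|a| = k%:C.
  by exists (complex.Re `|a|); rewrite RRe_real ?normr_real.
exists (k * s + t) => x; rewrite !fctE.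
apply: (le_trans (ler_normD _ _)).
rewrite rmorphD mulrDl lerD// normrZ ak rmorphM /= -mulrA.
by rewrite ler_wpM2l// -ak.
Qed.

HB.instance Definition _ :=
  GRing.isSubmodClosed.Build R[i] (H -> H) bounded_linear_pred
    bounded_linear_submod.
HB.instance Definition _ := [SubChoice_isSubLmodule of bop by <:].

Fact bop_one_subproof : (@idfun H) \in bounded_linear_pred.
Proof. by apply/mem_set; split=> //; exists 1 => x /=; rewrite mul1r. Qed.

Definition bop_one : bop := Bop bop_one_subproof.

Fact bop_mul_subproof (A B : bop) : A \o B \in bounded_linear_pred.
Proof.
have [linA [a ha]] := bopP A; have [linB [b hb]] := bopP B.
apply/mem_set; split; first by move=> c x y /=; rewrite linB linA.
exists (`|a| * b) => x /=; apply: (le_trans (ha _)).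
apply: (@le_trans _ _ (`|a|%:C * `|B x|)).
  by rewrite ler_wpM2r// lecR ler_norm.
by rewrite rmorphM /= -mulrA ler_wpM2l// lecR.
Qed.

Definition bop_mul (A B : bop) : bop := Bop (bop_mul_subproof A B).

Fact bop_mulA : associative bop_mul.
Proof. by move=> A B C; apply: bop_eqP. Qed.
Fact bop_mul1l : left_id bop_one bop_mul.
Proof. by move=> A; apply: bop_eqP. Qed.
Fact bop_mul1r : right_id bop_one bop_mul.
Proof. by move=> A; apply: bop_eqP. Qed.
Fact bop_mulDl : left_distributive bop_mul +%R.
Proof. by move=> A B C; apply: bop_eqP. Qed.
Fact bop_mulDr : right_distributive bop_mul +%R.
Proof.
move=> A B C; apply: bop_eqP => x; have [linA _] := bopP A.
by have := linA 1 (B x) (C x); rewrite !scale1r.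
Qed.

(* Only a possibly trivial ring, because [H] may be the zero space. *)
HB.instance Definition _ := GRing.Zmodule_isPzRing.Build bop
  bop_mulA bop_mul1l bop_mul1r bop_mulDl bop_mulDr.

End BoundedOperators.

Notation "''B' ( H )" := (bop H) : type_scope.

Section OperatorTheory.
Context {R : realType} {H : hilbertType R}.
Implicit Types A B : 'B(H).

Definition self_adjoint A : Prop := forall x y : H, hdot (A x) y = hdot x (A y).

(* [0 <= z] in [R[i]] says that [z] is real and nonnegative. *)
Definition positive_op A : Prop := forall x : H, 0 <= hdot (A x) x.

Definition loewner_le A B : Prop := positive_op (B - A).

Definition is_inverse A B : Prop := A * B = 1 /\ B * A = 1.

Definition invertible_op A : Prop := exists B, is_inverse A B.

(* Equal to [0] when [A] is not invertible. *)
Definition inv_op A : 'B(H) := xget 0 [set B | is_inverse A B].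

Definition strictly_positive_op A : Prop := positive_op A /\ invertible_op A.

Definition spectrum A : set R[i] := [set z | ~ invertible_op (A - z *: (1 : 'B(H)))].

Definition scalar_op (r : R) : 'B(H) := r%:C *: (1 : 'B(H)).

Definition poly_op (p : {poly R}) A : 'B(H) := \sum_(i < size p) (p`_i)%:C *: (A ^+ i : 'B(H)).

Definition opnorm_le A (e : R) : Prop := forall x : H, `|A x| <= e%:C * `|x|.

(* [B] is the value at [A] of the continuous functional calculus: it is the norm
   limit of the operators [p(A)] for real polynomials [p] approaching [f]
   uniformly on the spectrum of [A]. For [A] self-adjoint and [f] continuous on
   the (real, compact) spectrum of [A] there is exactly one such [B]. *)
Definition is_fun_calc (f : R -> R) A B : Prop :=
  forall e : R, 0 < e -> exists p : {poly R},
    (forall t : R, spectrum A t%:C -> `|f t - p.[t]| <= e) /\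
    opnorm_le (poly_op p A - B) e.

Definition fun_calc (f : R -> R) A : 'B(H) := xget 0 [set B | is_fun_calc f A B].

Definition sqrt_op A : 'B(H) := fun_calc Num.sqrt A.

Definition geometric_mean A B : 'B(H) :=
  let S := sqrt_op A in let T := inv_op S in S * sqrt_op (T * B * T) * S.

Definition positive_map (Phi : 'B(H) -> 'B(H)) : Prop :=
  forall A, positive_op A -> positive_op (Phi A).

End OperatorTheory.

Notation "A ⪯ B" := (loewner_le A B) : ring_scope.
Notation "A ♯ B" := (geometric_mean A B)
  (at level 40, left associativity) : ring_scope.

Section OperatorMonotone.
Context {R : realType}.
Implicit Types f : R -> R.

Definition continuous_on_pos f : Prop :=
  {within [set t : R | 0 < t], continuous f}.

(* [0 < z] in [R[i]] says that [z] is real and positive. *)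
Definition spectrum_pos (H : hilbertType R) (A : 'B(H)) : Prop :=
  forall z, spectrum A z -> 0 < z.

(* The operators range over all complex Hilbert spaces: on one fixed space of
   dimension 1 every increasing continuous function would qualify. *)
Definition operator_monotone f : Prop :=
  continuous_on_pos f /\
  forall (H : hilbertType R) (A B : 'B(H)),
    self_adjoint A -> self_adjoint B -> spectrum_pos A -> spectrum_pos B ->
    A ⪯ B -> fun_calc f A ⪯ fun_calc f B.

Definition operator_monotone_decreasing f : Prop :=
  continuous_on_pos f /\
  forall (H : hilbertType R) (A B : 'B(H)),
    self_adjoint A -> self_adjoint B -> spectrum_pos A -> spectrum_pos B ->
    A ⪯ B -> fun_calc f B ⪯ fun_calc f A.

End OperatorMonotone.

(* Main.v *)
Require Import Defs.
From HB Require Import structures.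
From mathcomp Require Import all_boot all_order all_algebra.
From mathcomp Require Import all_classical all_reals.
From mathcomp Require Import topology normedtype sequences derive realfun.
From mathcomp Require Import sesquilinear complex.
From mathcomp Require Import ring lra.

Set Implicit Arguments.
Unset Strict Implicit.
Unset Printing Implicit Defensive.

Import Order.TTheory GRing.Theory Num.Theory Num.Def numFieldNormedType.Exports.

Local Open Scope ring_scope.
Local Open Scope complex_scope.

(* The Kantorovich bound A / (Mm) + A^-1 <= (M + m) / (Mm) follows from
   (A - m)(M - A) >= 0; applying Phi and an operator monotone f gives the first
   inequality. The second is operator concavity of f: the block matrix
   [[P, Q], [Q, P]] with P = (X + Y) / 2 and Q = (X - Y) / 2 is unitarily
   equivalent to diag(X, Y) and is dominated by diag(P + d, P + Q^2 / d), so
   monotonicity of f on H (+) H, read on the upper left block, gives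
   (f(X) + f(Y)) / 2 <= f(P + d), and d tends to 0. The third is
   (A + B) / 2 - S D S = S (1 - D)^2 S / 2 for A = S^2 and B = S D^2 S. For a
   decreasing g, the same holds for the monotone function 1 / g, and inversion
   reverses the order.

   All of this rests on the continuous functional calculus, that is on the bound
   of |p(A)| by the maximum of |p| over the spectrum of a self-adjoint A: if N is
   the norm of T = p(A) then T^2 - N^2 is not invertible, and factoring
   p^2 - N^2 into linear factors yields a point of the spectrum where |p| = N. *)

(** * Real inner product and operator order *)

(** Operator monotonicity speaks of all Hilbert spaces, and concavity is extracted from it on a
    space twice as large; so H (+) H must first be made a Hilbert space, with its own Euclidean
    norm, completeness and inner product.

    The parameter d cannot be avoided: with P itself in the upper corner, the difference to be shown
    positive would be [[0, - Q], [- Q, Z]], which is positive only for Q = 0. A small d in one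
    corner is paid for by Q^2 / d in the other. That corner blows up as d tends to 0, but the
    conclusion is tested on vectors (u, 0) only and never sees it. Both corners stay above the
    common scalar lower bound of X and Y, so f is only ever evaluated on (0, oo).

    The positivity premises inside the conclusions are the domains of the operations: the geometric
    mean takes strictly positive arguments, and passing to 1 / g takes g > 0. *)

Section RealInnerProduct.
Context {R : realType} {H : hilbertType R}.
Implicit Types (x y z : H) (a r : R).

(** Real-valued, so that estimates are within reach of [lra]. Nothing is lost: [hdotE] recovers the
    imaginary part from ['i *: y]. *)
Definition ip x y : R := complex.Re (hdot x y).

Definition rnorm x : R := complex.Re `|x|.

Lemma rnormE x : `|x| = (rnorm x)%:C.
Proof. by rewrite /rnorm RRe_real// normr_real. Qed.

Lemma rnorm_ge0 x : 0 <= rnorm x.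
Proof. by rewrite -ler0c -rnormE. Qed.

Lemma rnorm0 : rnorm 0 = 0.
Proof. by rewrite /rnorm normr0. Qed.

Lemma rnorm_eq0 x : (rnorm x == 0) = (x == 0).
Proof. by rewrite -[RHS]normr_eq0 rnormE (inj_eq (@complexI R)). Qed.

Lemma rnorm_gt0 x : (0 < rnorm x) = (x != 0).
Proof. by rewrite lt_def rnorm_ge0 andbT rnorm_eq0. Qed.

Lemma rnormD x y : rnorm (x + y) <= rnorm x + rnorm y.
Proof. by rewrite -lecR rmorphD/= -!rnormE ler_normD. Qed.

Lemma rnormN x : rnorm (- x) = rnorm x.
Proof. by rewrite /rnorm normrN. Qed.

Lemma rnormB x y : rnorm (x - y) = rnorm (y - x).
Proof. by rewrite -rnormN opprB. Qed.

Lemma rnorm_distD z x y : rnorm (x - y) <= rnorm (x - z) + rnorm (z - y).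
Proof. by rewrite (le_trans _ (rnormD _ _))// addrA subrK. Qed.

Lemma normcR a : `|a%:C| = `|a|%:C :> R[i].
Proof. by rewrite normc_def /= expr0n/= addr0 sqrtr_sqr. Qed.

Lemma rnormZ a x : rnorm (a%:C *: x) = `|a| * rnorm x.
Proof.
by apply: (@complexI R); rewrite -rnormE normrZ normcR rmorphM/= -rnormE.
Qed.

Lemma hdotDl x y z : hdot (x + y) z = hdot x z + hdot y z.
Proof. exact: linearDl. Qed.
Lemma hdotDr x y z : hdot x (y + z) = hdot x y + hdot x z.
Proof. exact: linearDr. Qed.
Lemma hdotZl (c : R[i]) x y : hdot (c *: x) y = c * hdot x y.
Proof. exact: linearZl_LR. Qed.
Lemma hdotZr (c : R[i]) x y : hdot x (c *: y) = c^* * hdot x y.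
Proof. exact: linearZr_LR. Qed.
Lemma hdotC x y : hdot x y = (hdot y x)^*.
Proof. by rewrite hermitian_subproof expr0 mul1r. Qed.

Lemma ipC x y : ip x y = ip y x.
Proof. by rewrite /ip hdotC; case: (hdot y x). Qed.
Lemma ipDl x y z : ip (x + y) z = ip x z + ip y z.
Proof. by rewrite /ip hdotDl raddfD. Qed.
Lemma ipDr x y z : ip x (y + z) = ip x y + ip x z.
Proof. by rewrite !(ipC x) ipDl. Qed.
Lemma ipZl a x y : ip (a%:C *: x) y = a * ip x y.
Proof. by rewrite /ip hdotZl; case: (hdot x y) => u v /=; rewrite mul0r subr0. Qed.
Lemma ipZr a x y : ip x (a%:C *: y) = a * ip x y.
Proof. by rewrite !(ipC x) ipZl. Qed.
Lemma ipNl x y : ip (- x) y = - ip x y.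
Proof. by rewrite -scaleN1r -[-1](rmorphN1 (real_complex R)) ipZl mulN1r. Qed.
Lemma ipNr x y : ip x (- y) = - ip x y.
Proof. by rewrite !(ipC x) ipNl. Qed.
Lemma ipBl x y z : ip (x - y) z = ip x z - ip y z.
Proof. by rewrite ipDl ipNl. Qed.
Lemma ipBr x y z : ip x (y - z) = ip x y - ip x z.
Proof. by rewrite ipDr ipNr. Qed.

Lemma ipii x : ip x x = rnorm x ^+ 2.
Proof. by rewrite /ip -hdot_norm rnormE -rmorphXn. Qed.

Lemma ipi x y : ip ('i *: x) y = - ip x ('i *: y).
Proof. by rewrite /ip hdotZl hdotZr; case: (hdot x y) => u v /=; ring. Qed.

Lemma hdotE x y : hdot x y = Complex (ip x y) (ip x ('i *: y)).
Proof.
by rewrite /ip hdotZr; case: (hdot x y) => u v /=; congr Complex; ring.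
Qed.

Lemma rnormD_sqr x y : rnorm (x + y) ^+ 2 = rnorm x ^+ 2 + 2 * ip x y + rnorm y ^+ 2.
Proof. by rewrite -!ipii !(ipDl, ipDr) (ipC y x); ring. Qed.

Lemma rnormB_sqr x y : rnorm (x - y) ^+ 2 = rnorm x ^+ 2 - 2 * ip x y + rnorm y ^+ 2.
Proof. by rewrite rnormD_sqr ipNr rnormN; ring. Qed.

End RealInnerProduct.

Section Operators.
Context {R : realType} {H : hilbertType R}.
Implicit Types (A B C : 'B(H)) (x y : H) (a e r : R).

HB.instance Definition _ A := GRing.isLinear.Build R[i] H H _ (bop_fun A) (bopP A).1.

Lemma bopDE A B x : (A + B) x = A x + B x. Proof. by []. Qed.
Lemma bopNE A x : (- A) x = - A x. Proof. by []. Qed.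
Lemma bopBE A B x : (A - B) x = A x - B x. Proof. by []. Qed.
Lemma bopZE (c : R[i]) A x : (c *: A) x = c *: A x. Proof. by []. Qed.
Lemma bopME A B x : (A * B) x = A (B x). Proof. by []. Qed.
Lemma bop1E x : (1 : 'B(H)) x = x. Proof. by []. Qed.
Lemma bop0E x : (0 : 'B(H)) x = 0. Proof. by []. Qed.
Lemma scalar_opE r x : (scalar_op r : 'B(H)) x = r%:C *: x. Proof. by []. Qed.
Definition bopE := (bopDE, bopNE, bopZE, bopME, bop1E, bop0E, scalar_opE).

Lemma bopZAl (c : R[i]) A B : (c *: A) * B = c *: (A * B).
Proof. exact: bop_eqP. Qed.
Lemma bopZAr (c : R[i]) A B : A * (c *: B) = c *: (A * B).
Proof. by apply: bop_eqP => x; rewrite !bopE linearZ. Qed.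

Lemma opnorm_leP A e : opnorm_le A e <-> forall x, rnorm (A x) <= e * rnorm x.
Proof.
by split=> h x; have := h x; rewrite !rnormE -rmorphM lecR.
Qed.

Lemma opnorm_leW A e r : e <= r -> opnorm_le A e -> opnorm_le A r.
Proof.
move=> er /opnorm_leP h; apply/opnorm_leP => x; apply: (le_trans (h x)).
by rewrite ler_wpM2r// rnorm_ge0.
Qed.

Lemma opnorm_le0 e : 0 <= e -> opnorm_le (0 : 'B(H)) e.
Proof.
by move=> e0; apply/opnorm_leP => x; rewrite bopE rnorm0 mulr_ge0// rnorm_ge0.
Qed.

Lemma opnorm_le1 : opnorm_le (1 : 'B(H)) 1.
Proof. by apply/opnorm_leP => x; rewrite bopE mul1r. Qed.

Lemma opnorm_leD A B e r :
  opnorm_le A e -> opnorm_le B r -> opnorm_le (A + B) (e + r).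
Proof.
move=> /opnorm_leP hA /opnorm_leP hB; apply/opnorm_leP => x.
by rewrite bopE mulrDl (le_trans (rnormD _ _))// lerD.
Qed.

Lemma opnorm_leN A e : opnorm_le A e -> opnorm_le (- A) e.
Proof.
by move=> /opnorm_leP h; apply/opnorm_leP => x; rewrite bopE rnormN.
Qed.

Lemma opnorm_leB A B e : opnorm_le (A - B) e -> opnorm_le (B - A) e.
Proof. by move=> /opnorm_leN; rewrite opprB. Qed.

Lemma opnorm_leM A B e r : 0 <= e ->
  opnorm_le A e -> opnorm_le B r -> opnorm_le (A * B) (e * r).
Proof.
move=> e0 /opnorm_leP hA /opnorm_leP hB; apply/opnorm_leP => x.
by rewrite bopE (le_trans (hA _))// -mulrA ler_wpM2l.
Qed.

Lemma opnorm_le_dist C A B e r :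
  opnorm_le (A - C) e -> opnorm_le (C - B) r -> opnorm_le (A - B) (e + r).
Proof. by move=> hA /(opnorm_leD hA); rewrite addrA subrK. Qed.

Lemma opnorm_bound A : exists2 k, 0 < k & opnorm_le A k.
Proof.
have [_ [k hk]] := bopP A; exists (`|k| + 1); first by rewrite ltr_wpDl.
by apply: opnorm_leW hk; rewrite (le_trans (ler_norm k))// lerDl.
Qed.

Lemma opnorm_small_eq A B :
  (forall e, 0 < e -> opnorm_le (A - B) e) -> A = B.
Proof.
move=> h; apply: bop_eqP => x; apply/eqP; rewrite -subr_eq0 -rnorm_eq0.
rewrite eq_le rnorm_ge0 andbT; apply/ler_addgt0Pl => e e0; rewrite addr0.
have x0 : 0 < rnorm x + 1 by rewrite ltr_wpDl// rnorm_ge0.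
have /opnorm_leP/(_ x) := h _ (divr_gt0 e0 x0); rewrite bopE => /le_trans; apply.
by rewrite mulrAC ler_pdivrMr// ler_wpM2l ?lerDl// ltW.
Qed.

Lemma self_adjointP A : self_adjoint A <-> forall x y, ip (A x) y = ip x (A y).
Proof.
split=> [h x y|h x y]; first by rewrite /ip h.
by rewrite !hdotE !h linearZ.
Qed.

(** Polarization: the quadratic form is real at every vector, and its vanishing imaginary part at
    ['i *: x + y] is the symmetry of the real part. *)
Lemma positive_self_adjoint A : positive_op A -> self_adjoint A.
Proof.
move=> pA; apply/self_adjointP => x y.
have im0 z : ip (A z) ('i *: z) = 0.
  by have := pA z; rewrite hdotE lecE /= => /andP[/eqP].
have := im0 ('i *: x + y); rewrite !(linearD, linearZ, ipDl, ipDr) /=.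
have i2 z : 'i *: ('i *: z : H) = - z.
  by rewrite scalerA -expr2 sqr_i scaleN1r.
rewrite !i2 !(ipNr, ipNl, ipi, im0, i2).
by rewrite (ipC x); lra.
Qed.

Lemma positive_opP A :
  positive_op A <-> self_adjoint A /\ forall x, 0 <= ip (A x) x.
Proof.
split=> [pA|[sA h] x].
  split=> [|x]; first exact: positive_self_adjoint.
  by have := pA x; rewrite hdotE lecE /= => /andP[].
rewrite hdotE lecE /= h andbT.
have : ip (A x) ('i *: x) = - ip x ('i *: A x) by rewrite -ipi ipC ipi ipC.
by rewrite -linearZ -[ip x _](self_adjointP A).1// => ?; apply/eqP; lra.
Qed.

Lemma self_adjoint1 : self_adjoint (1 : 'B(H)).
Proof. by []. Qed.
Lemma self_adjointD A B : self_adjoint A -> self_adjoint B -> self_adjoint (A + B).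
Proof.
move=> /self_adjointP sA /self_adjointP sB; apply/self_adjointP => x y.
by rewrite !bopE ipDl ipDr sA sB.
Qed.
Lemma self_adjointN A : self_adjoint A -> self_adjoint (- A).
Proof.
move=> /self_adjointP sA; apply/self_adjointP => x y.
by rewrite !bopE ipNl ipNr sA.
Qed.
Lemma self_adjointB A B : self_adjoint A -> self_adjoint B -> self_adjoint (A - B).
Proof. by move=> sA sB; apply/self_adjointD => //; apply: self_adjointN. Qed.
Lemma self_adjointZ a A : self_adjoint A -> self_adjoint (a%:C *: A).
Proof.
move=> /self_adjointP sA; apply/self_adjointP => x y.
by rewrite !bopE ipZl ipZr sA.
Qed.
Lemma self_adjoint_scalar a : self_adjoint (scalar_op a : 'B(H)).
Proof. exact/self_adjointZ/self_adjoint1. Qed.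
Lemma self_adjointM A B : self_adjoint A -> self_adjoint B -> A * B = B * A ->
  self_adjoint (A * B).
Proof.
move=> /self_adjointP sA /self_adjointP sB AB; apply/self_adjointP => x y.
by rewrite {2}AB !bopE sA sB.
Qed.

Lemma loewner_leP A B : self_adjoint A -> self_adjoint B ->
  (A ⪯ B <-> forall x, ip (A x) x <= ip (B x) x).
Proof.
move=> sA sB; rewrite /loewner_le; split.
  by move=> /positive_opP[_ h] x; rewrite -subr_ge0 -ipBl -bopBE.
move=> h; apply/positive_opP; split; first exact: self_adjointB.
by move=> x; rewrite bopBE ipBl subr_ge0.
Qed.

Lemma positive_opD A B : positive_op A -> positive_op B -> positive_op (A + B).
Proof. by move=> pA pB x; rewrite bopE hdotDl addr_ge0. Qed.

Lemma positive_opZ a A : 0 <= a -> positive_op A -> positive_op (a%:C *: A).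
Proof. by move=> a0 pA x; rewrite bopE hdotZl mulr_ge0// ler0c. Qed.

Lemma positive_conj S A : self_adjoint S -> positive_op A -> positive_op (S * A * S).
Proof. by move=> sS pA x; rewrite !bopE sS. Qed.

Lemma positive_sqr A : self_adjoint A -> positive_op (A * A).
Proof. by move=> sA x; rewrite bopE sA. Qed.

Lemma loewner_trans B A C : A ⪯ B -> B ⪯ C -> A ⪯ C.
Proof.
by move=> AB BC; rewrite /loewner_le -(subrK B C) -addrA; apply: positive_opD.
Qed.

Lemma loewner_self_adjoint a A : scalar_op a ⪯ A -> self_adjoint A.
Proof.
move=> /positive_self_adjoint h; rewrite -(subrK (scalar_op a) A).
exact/self_adjointD/self_adjoint_scalar.
Qed.

Lemma scalar_leP a A : self_adjoint A ->
  scalar_op a ⪯ A <-> forall x, a * rnorm x ^+ 2 <= ip (A x) x.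
Proof.
move=> sA; rewrite loewner_leP//; last exact: self_adjoint_scalar.
by split=> h x; have := h x; rewrite scalar_opE ipZl ipii.
Qed.

Lemma le_scalarP a A : self_adjoint A ->
  A ⪯ scalar_op a <-> forall x, ip (A x) x <= a * rnorm x ^+ 2.
Proof.
move=> sA; rewrite loewner_leP//; last exact: self_adjoint_scalar.
by split=> h x; have := h x; rewrite scalar_opE ipZl ipii.
Qed.

(** Expand the squared norms of [A x - k x] and [A x + k x], both nonnegative, and bound that of
    [A x] by [k ^+ 2 * rnorm x ^+ 2]. *)
Lemma ip_le_opnorm A k x : 0 < k -> opnorm_le A k -> `|ip (A x) x| <= k * rnorm x ^+ 2.
Proof.
move=> k0 /opnorm_leP/(_ x) h.
have h2 : rnorm (A x) ^+ 2 <= k ^+ 2 * rnorm x ^+ 2.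
  by rewrite -exprMn lerXn2r// nnegrE ?mulr_ge0 ?rnorm_ge0// ltW.
have h1 := sqr_ge0 (rnorm (A x - k%:C *: x)).
have h3 := sqr_ge0 (rnorm (A x + k%:C *: x)).
move: h1 h3; rewrite rnormB_sqr rnormD_sqr !ipZr !rnormZ (ger0_norm (ltW k0)) exprMn => h1 h3.
rewrite ler_norml; apply/andP; split; rewrite -(ler_pM2l k0); lra.
Qed.

Lemma self_adjoint_bounds A : self_adjoint A -> exists2 k, 0 < k &
  scalar_op (- k) ⪯ A /\ A ⪯ scalar_op k.
Proof.
move=> sA; have [k k0 hk] := opnorm_bound A; exists k => //.
split; [apply/scalar_leP|apply/le_scalarP] => // x.
  by have := ip_le_opnorm x k0 hk; rewrite ler_norml mulNr => /andP[].
by have := ip_le_opnorm x k0 hk; rewrite ler_norml => /andP[].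
Qed.

End Operators.

(** * Completeness and invertibility *)

Section Completeness.
Context {R : realType} {H : hilbertType R}.
Implicit Types (x y : H) (a e r : R).

Lemma rnorm_cauchy_cvg (u : nat -> H) :
  (forall e, 0 < e -> exists N, forall n, (N <= n)%N -> rnorm (u N - u n) <= e) ->
  exists l, forall e, 0 < e -> exists N, forall n, (N <= n)%N -> rnorm (u n - l) <= e.
Proof.
move=> hu.
have /cvg_ex[/= l ul] : cvg (u @ \oo)%classic.
  apply: cauchy_cvg; apply: cauchy_exP => e e0.
  have eR : e = (complex.Re e)%:C by rewrite RRe_real// gtr0_real.
  have e20 : 0 < complex.Re e / 2 by rewrite divr_gt0// -ltcR -eR.
  have [N hN] := hu _ e20; exists (u N); exists N => // n /= Nn.
  rewrite -ball_normE /= rnormE eR ltcR (le_lt_trans (hN _ Nn))//.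
  by rewrite ltr_pdivrMr// ltr_pMr ?ltr1n// -ltcR -eR.
exists l => e e0; have /cvgrPdist_le /(_ e%:C) := ul.
rewrite ltcR => /(_ e0)[N _ hN]; exists N => n Nn.
by have := hN n Nn; rewrite /= rnormB rnormE lecR.
Qed.

Lemma rnorm_small_eq x y : (forall e, 0 < e -> rnorm (x - y) <= e) -> x = y.
Proof.
move=> h; apply/eqP; rewrite -subr_eq0 -rnorm_eq0 eq_le rnorm_ge0 andbT.
by apply/ler_addgt0Pl => e e0; rewrite addr0 h.
Qed.

Lemma rnormZc (c : R[i]) x : rnorm (c *: x) = complex.Re `|c| * rnorm x.
Proof.
apply: (@complexI R).
by rewrite -rnormE normrZ rnormE rmorphM /= RRe_real// normr_real.
Qed.

(** The limit is taken pointwise; the Cauchy rate is uniform on bounded sets, which makes the limit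
    linear, bounded and a limit in norm. *)
Lemma opnorm_cauchy_cvg (A_ : nat -> 'B(H)) :
  (forall e, 0 < e -> exists N, forall n, (N <= n)%N -> opnorm_le (A_ N - A_ n) e) ->
  exists B : 'B(H), forall e, 0 < e ->
    exists N, forall n, (N <= n)%N -> opnorm_le (A_ n - B) e.
Proof.
move=> hA.
have hA2 e : 0 < e -> exists N, forall n m, (N <= n)%N -> (N <= m)%N ->
    forall x, rnorm (A_ n x - A_ m x) <= e * rnorm x.
  move=> e0; have [N hN] := hA _ (divr_gt0 e0 (ltr0n _ 2)).
  exists N => n m Nn Nm x.
  have := opnorm_le_dist (opnorm_leB (hN n Nn)) (hN m Nm).
  by rewrite -splitr => /opnorm_leP; apply.
have hl x : exists l, forall e, 0 < e ->
    exists N, forall n, (N <= n)%N -> rnorm (A_ n x - l) <= e.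
  apply: rnorm_cauchy_cvg => e e0.
  have x0 : 0 < rnorm x + 1 by rewrite ltr_wpDl// rnorm_ge0.
  have [N hN] := hA2 _ (divr_gt0 e0 x0); exists N => n Nn.
  rewrite (le_trans (hN _ _ (leqnn _) Nn _))// mulrAC ler_pdivrMr//.
  by rewrite ler_wpM2l ?lerDl// ltW.
have [B hB] := choice hl.
have BN e : 0 < e -> exists N, forall n, (N <= n)%N ->
    forall x, rnorm (A_ n x - B x) <= e * rnorm x.
  move=> e0; have [N hN] := hA2 _ e0; exists N => n Nn x.
  (* The index [M] depends on [x], but it enters only through the arbitrary error [d]; the rate [N]
     does not depend on [x]. *)
  apply/ler_addgt0Pl => d d0; have [M hM] := hB x _ d0.
  rewrite (le_trans (rnorm_distD (A_ (maxn N M) x) _ _))// addrC.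
  by rewrite lerD ?hM ?hN ?leq_maxl ?leq_maxr.
have linB : linear B.
  move=> c x y; apply: rnorm_small_eq => e e0.
  set k := complex.Re `|c|.
  have k0 : 0 <= k by rewrite -ler0c RRe_real ?normr_real.
  have s0 : 0 < k * rnorm x + rnorm y + rnorm (c *: x + y) + 1.
    by rewrite ltr_wpDl// !addr_ge0 ?mulr_ge0 ?rnorm_ge0.
  have [N hN] := BN _ (divr_gt0 e0 s0); have {}hN := hN N (leqnn N).
  have -> : B (c *: x + y) - (c *: B x + B y) =
      - (A_ N (c *: x + y) - B (c *: x + y)) + (c *: (A_ N x - B x) + (A_ N y - B y)).
    rewrite (linearD (A_ N)) (linearZ_LR (A_ N)) scalerBr opprB.
    by rewrite [X in _ = _ + X]addrACA -opprD addrA subrK.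
  rewrite (le_trans (rnormD _ _))// rnormN.
  rewrite (le_trans (lerD (hN _) (rnormD _ _)))// rnormZc.
  rewrite (le_trans (lerD (lexx _) (lerD (ler_wpM2l k0 (hN _)) (hN _))))//.
  rewrite mulrCA -!mulrDr mulrAC ler_pdivrMr// ler_wpM2l 1?ltW//.
  by rewrite -/k; lra.
have bB : B \in @bounded_linear_pred R H.
  apply/mem_set; split => //; have [N hN] := BN 1 ltr01.
  have [k k0 /opnorm_leP hk] := opnorm_bound (A_ N).
  exists (1 + k) => x; rewrite !rnormE -rmorphM lecR.
  rewrite -[B x](subrK (A_ N x)) (le_trans (rnormD _ _))// mulrDl lerD//.
  by rewrite rnormB hN.
exists (Bop bB) => e e0; have [N hN] := BN _ e0; exists N => n Nn.
by apply/opnorm_leP => x; exact: hN.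
Qed.

End Completeness.

Lemma realC_eq0 (R : realType) (a : R) : (a%:C == 0 :> R[i]) = (a == 0).
Proof. exact: (inj_eq (@complexI R) a 0). Qed.

Lemma half_real (R : realType) : (2^-1 : R[i]) = (2^-1 : R)%:C.
Proof. by rewrite fmorphV rmorph_nat. Qed.

Section Invertibility.
Context {R : realType} {H : hilbertType R}.
Implicit Types (A B C S T : 'B(H)) (x y : H) (a e r q : R).

Lemma opnorm_leX S q n : 0 <= q -> opnorm_le S q -> opnorm_le (S ^+ n : 'B(H)) (q ^+ n).
Proof.
move=> q0 hS; elim: n => [|n IH]; first exact: opnorm_le1.
by rewrite !exprS; apply: opnorm_leM.
Qed.

Lemma expr_small q e : 0 <= q -> q < 1 -> 0 < e -> exists n, q ^+ n <= e.
Proof.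
move=> q0 q1 e0; have : `|q| < 1 by rewrite ger0_norm.
move/cvg_expr/cvgrPdist_le => /(_ _ e0)[N _ /(_ N (leqnn N))].
by rewrite /= sub0r normrN ger0_norm ?exprn_ge0// => ?; exists N.
Qed.

Lemma neumann_series S q : 0 <= q -> q < 1 -> opnorm_le S q ->
  invertible_op (1 - S).
Proof.
move=> q0 q1 hS; pose A_ n : 'B(H) := \sum_(i < n) S ^+ i.
have q10 : 0 < 1 - q by rewrite subr_gt0.
(* The bound is the exact value of the geometric sum of [q ^+ i] for n <= i < n + k, which lets the
   induction on [k] close. *)
have dA n k : opnorm_le (A_ (n + k)%N - A_ n) ((q ^+ n - q ^+ (n + k)) / (1 - q)).
  elim: k => [|k IH]; first by rewrite addn0 !subrr mul0r; exact: opnorm_le0.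
  rewrite addnS /A_ big_ord_recr /= -addrA addrCA addrC.
  have -> : (q ^+ n - q ^+ (n + k).+1) / (1 - q) =
      (q ^+ n - q ^+ (n + k)) / (1 - q) + q ^+ (n + k).
    by rewrite exprS; field; rewrite gt_eqF.
  exact/opnorm_leD/opnorm_leX.
have SA n : (1 - S) * A_ n = 1 - S ^+ n /\ A_ n * (1 - S) = 1 - S ^+ n.
  elim: n => [|n [IH1 IH2]]; first by rewrite /A_ big_ord0 mulr0 mul0r subrr.
  have -> : A_ n.+1 = A_ n + S ^+ n by rewrite /A_ big_ord_recr.
  rewrite mulrDr IH1 [(A_ n + _) * _]mulrDl IH2 mulrBl mulrBr mul1r mulr1.
  by rewrite -exprS -exprSr addrA subrK.
have [|B hB] := @opnorm_cauchy_cvg R H A_.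
  move=> e e0; have [N hN] := expr_small q0 q1 (mulr_gt0 e0 q10).
  exists N => n Nn; rewrite -(subnKC Nn); apply: opnorm_leB.
  apply: opnorm_leW (dA _ _); rewrite ler_pdivrMr//.
  by rewrite (le_trans _ hN)// lerBlDr lerDl exprn_ge0.
have [k k0 hk] := opnorm_bound (1 - S).
have BN e : 0 < e -> exists2 n, opnorm_le (A_ n - B) e & opnorm_le (S ^+ n : 'B(H)) e.
  move=> e0; have [N hN] := expr_small q0 q1 e0; have [M hM] := hB _ e0.
  exists (maxn N M); first by apply: hM; rewrite leq_maxr.
  apply: opnorm_leW (opnorm_leX _ q0 hS); apply: le_trans hN.
  by rewrite ler_wiXn2l// ?(ltW q1)// leq_maxl.
have k1 : 0 < k + 1 by rewrite ltr_wpDl// ltW.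
have ke e : k * (e / (k + 1)) + e / (k + 1) = e.
  by field; rewrite gt_eqF.
exists B; split; apply: opnorm_small_eq => e e0;
  have [n h1 h2] := BN _ (divr_gt0 e0 k1); rewrite -[e]ke.
  have -> : (1 - S) * B - 1 = - ((1 - S) * (A_ n - B)) - S ^+ n.
    by rewrite mulrBr (SA n).1 opprB -addrA -opprD subrK.
  exact: opnorm_leD (opnorm_leN (opnorm_leM (ltW k0) hk h1)) (opnorm_leN h2).
have -> : B * (1 - S) - 1 = - ((A_ n - B) * (1 - S)) - S ^+ n.
  by rewrite mulrBl (SA n).2 opprB -addrA -opprD subrK.
rewrite [k * _]mulrC; apply: opnorm_leD (opnorm_leN h2).
by apply/opnorm_leN/opnorm_leM => //; rewrite ltW// divr_gt0.
Qed.

Lemma is_inverse_inv A B : is_inverse A B -> inv_op A = B.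
Proof.
move=> [AB BA]; have [AC CA] : is_inverse A (inv_op A).
  by rewrite /inv_op; case: xgetP => [C _ //|/(_ B)[]].
by rewrite -[inv_op A]mul1r -BA -mulrA AC mulr1.
Qed.

Lemma invertible_inv A : invertible_op A -> is_inverse A (inv_op A).
Proof. by move=> [B AB]; rewrite (is_inverse_inv AB). Qed.

Lemma invertible_scale c A : c != 0 -> invertible_op (c *: A) -> invertible_op A.
Proof.
move=> c0 [B [h1 h2]]; exists (c *: B).
by rewrite /is_inverse bopZAr -bopZAl h1 bopZAl -bopZAr.
Qed.

Lemma invertible_mul A B : invertible_op A -> invertible_op B -> invertible_op (A * B).
Proof.
move=> [A' [h1 h2]] [B' [h3 h4]]; exists (B' * A'); split.
  by rewrite mulrA -[A * B * B']mulrA h3 mulr1.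
by rewrite mulrA -[B' * A' * A]mulrA h2 mulr1.
Qed.

(** [B * C] is a right inverse of [A] and, by commutation, [C * B] is a left inverse; the two must
    then coincide. *)
Lemma invertible_mulI A B : A * B = B * A -> invertible_op (A * B) -> invertible_op A.
Proof.
move=> AB [C [h1 h2]]; have h3 : C * B * A = 1 by rewrite -mulrA -AB.
exists (B * C); split; first by rewrite mulrA.
suff -> : B * C = C * B by [].
by rewrite -[LHS]mul1r -h3 -!mulrA [A * (B * C)]mulrA h1 mulr1.
Qed.

(* For small s > 0 the operator 1 - s T is a strict contraction. *)
Lemma coercive_invertible T a : 0 < a ->
  (forall x, a * rnorm x ^+ 2 <= ip (T x) x) -> invertible_op T.
Proof.
move=> a0 hT; have [k0 k00 hk0] := opnorm_bound T.
pose k := k0 + a; have k1 : 0 < k by rewrite addr_gt0.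
have /opnorm_leP hk : opnorm_le T k by apply: opnorm_leW hk0; rewrite lerDl ltW.
(* The squared norm of [x - s T x] is at most 1 - 2 s a + s^2 k^2 times that of [x]. This [s]
   minimizes the factor, which becomes 1 - s a <= q^2. Adding [a] to [k0] ensures a <= k, hence s a
   <= 1. *)
pose s := a / k ^+ 2; pose q := 1 - s * a / 2.
have s0 : 0 < s by rewrite divr_gt0// exprn_gt0.
have ak : a <= k by rewrite lerDr ltW.
have sa1 : s * a <= 1.
  by rewrite /s mulrAC ler_pdivrMr ?exprn_gt0// mul1r -expr2 lerXn2r// nnegrE ltW.
have sa0 : 0 < s * a by rewrite mulr_gt0.
have [q0 q1] : 0 <= q /\ q < 1 by rewrite /q; lra.
have hS : opnorm_le (1 - s%:C *: T) q.
  apply/opnorm_leP => x; rewrite !bopE.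
  rewrite -(@ler_pXn2r _ 2)// ?nnegrE ?mulr_ge0 ?rnorm_ge0//.
  rewrite rnormB_sqr ipZr rnormZ ipC exprMn (gtr0_norm s0).
  have h1 : s * (a * rnorm x ^+ 2) <= s * ip (T x) x by rewrite ler_wpM2l// ltW.
  have h2 : (s * rnorm (T x)) ^+ 2 <= s * a * rnorm x ^+ 2.
    have -> : s * a * rnorm x ^+ 2 = s ^+ 2 * (k * rnorm x) ^+ 2.
      by rewrite {1 2}/s exprMn; field; rewrite gt_eqF.
    rewrite exprMn ler_wpM2l ?sqr_ge0// lerXn2r// nnegrE ?mulr_ge0 ?rnorm_ge0//.
    exact: ltW.
  have h3 : 0 <= (s * a) ^+ 2 * rnorm x ^+ 2 by rewrite mulr_ge0// sqr_ge0.
  by rewrite /q; move: h1 h2 h3; rewrite !exprMn; set X := rnorm x ^+ 2; nra.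
apply: (@invertible_scale s%:C); first by rewrite realC_eq0 gt_eqF.
have -> : s%:C *: T = 1 - (1 - s%:C *: T) by rewrite opprB addrC subrK.
exact: neumann_series hS.
Qed.

Lemma coercive_invertibleN T a : 0 < a ->
  (forall x, ip (T x) x <= - (a * rnorm x ^+ 2)) -> invertible_op T.
Proof.
move=> a0 hT; apply: (@invertible_scale (-1)); first by rewrite oppr_eq0 oner_eq0.
apply: (@coercive_invertible _ a) => // x.
by rewrite scaleN1r bopE ipNl lerNr.
Qed.

End Invertibility.

(** * Location of the spectrum of a self-adjoint operator *)

Section SpectrumBounds.
Context {R : realType} {H : hilbertType R}.
Implicit Types (A : 'B(H)) (a b : R).

(** For z = s + i t with t nonzero, the real quadratic form of i t (A - z) at [x] is
    [t ^+ 2 * rnorm x ^+ 2]: the contributions of A and s are imaginary after multiplication by i.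
    So A - z is coercive up to a scalar factor. *)
Lemma spectrum_real A (z : R[i]) : self_adjoint A -> spectrum A z -> z = (complex.Re z)%:C.
Proof.
move=> /self_adjointP sA; case: z => s t sz /=; congr Complex.
apply/eqP; apply: contrapT => /negP t0; apply: sz.
apply: (@invertible_scale _ _ (t%:C * 'i)).
  rewrite mulf_eq0 negb_or; apply/andP; split; first by rewrite realC_eq0.
  by rewrite -sqrf_eq0 sqr_i oppr_eq0 oner_eq0.
apply: (@coercive_invertible _ _ _ (t ^+ 2)); first by rewrite exprn_even_gt0.
move=> x; have Aii : ip (A x) ('i *: x) = 0.
  have : ip (A x) ('i *: x) = - ip (A x) ('i *: x).
    by rewrite -[in RHS]ipi -linearZ sA ipC.
  by lra.
have -> : s +i* t = s%:C + t%:C * 'i by rewrite [LHS]complexE /= [t%:C * _]mulrC.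
have ii0 : ip x ('i *: x) = 0 by have := ipi x x; rewrite ipC; lra.
have ii : ip ('i *: x) ('i *: x) = rnorm x ^+ 2.
  by rewrite ipi scalerA -expr2 sqr_i scaleN1r ipNr opprK ipii.
rewrite !bopE scalerDl -!scalerA ipZl ipi ipBl ipDl !ipZl Aii ii0 ii.
by rewrite expr2; lra.
Qed.

Lemma spectrum_bounds A a b z : scalar_op a ⪯ A -> A ⪯ scalar_op b ->
  spectrum A z -> exists2 t : R, a <= t <= b & z = t%:C.
Proof.
move=> aA Ab Az; have sA := loewner_self_adjoint aA.
exists (complex.Re z); last exact: spectrum_real.
have zE := spectrum_real sA Az; rewrite zE in Az; move: {zE}(complex.Re z) Az => t At.
apply/andP; split; rewrite leNgt; apply/negP => tab; apply: At.
  apply: (@coercive_invertible _ _ _ (a - t)); first by rewrite subr_gt0.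
  move=> x; rewrite !bopE ipBl ipZl ipii mulrBl lerB//.
  by have /scalar_leP := aA; apply.
apply: (@coercive_invertibleN _ _ _ (t - b)); first by rewrite subr_gt0.
move=> x; rewrite !bopE ipBl ipZl ipii mulrBl opprB lerB//.
by have /le_scalarP := Ab; apply.
Qed.

End SpectrumBounds.

Lemma ler_sqr_ge0 (R : realDomainType) (a b : R) : 0 <= a -> a <= b -> a ^+ 2 <= b ^+ 2.
Proof. by move=> a0 ab; rewrite lerXn2r// nnegrE// (le_trans a0). Qed.

(** * Polynomials of a self-adjoint operator *)

Section PolynomialCalculus.
Context {R : realType} {H : hilbertType R}.
Implicit Types (A : 'B(H)) (e : R).

(** Complex coefficients, because the spectral argument splits a polynomial into linear factors;
    [poly_opE] embeds the real calculus. *)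
Definition cpoly_op (p : {poly R[i]}) A : 'B(H) := \sum_(i < size p) p`_i *: A ^+ i.

Lemma cpoly_op_widen n (p : {poly R[i]}) A : (size p <= n)%N ->
  cpoly_op p A = \sum_(i < n) p`_i *: A ^+ i.
Proof.
move=> pn; rewrite /cpoly_op (big_ord_widen n (fun i => p`_i *: A ^+ i) pn).
rewrite big_mkcond; apply: eq_bigr => i _; case: ltnP => // ip.
by rewrite nth_default// scale0r.
Qed.

Lemma cpoly_opD p q A : cpoly_op (p + q) A = cpoly_op p A + cpoly_op q A.
Proof.
pose n := maxn (size p) (size q).
rewrite !(@cpoly_op_widen n) ?leq_maxl ?leq_maxr ?(leq_trans (size_polyD _ _))//.
by rewrite -big_split; apply: eq_bigr => i _; rewrite coefD scalerDl.
Qed.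

Lemma cpoly_opZ c p A : cpoly_op (c *: p) A = c *: cpoly_op p A.
Proof.
rewrite !(@cpoly_op_widen (size p)) ?size_scale_leq// scaler_sumr.
by apply: eq_bigr => i _; rewrite coefZ scalerA.
Qed.

Lemma cpoly_opC c A : cpoly_op c%:P A = c *: (1 : 'B(H)).
Proof. by rewrite (@cpoly_op_widen 1) ?size_polyC_leq1// big_ord1 coefC expr0. Qed.

Lemma cpoly_opMX p A : cpoly_op (p * 'X) A = cpoly_op p A * A.
Proof.
rewrite (@cpoly_op_widen (size p).+1); last first.
  by rewrite (leq_trans (size_polyMleq _ _))// size_polyX addn2.
rewrite big_ord_recl coefMX/= scale0r add0r mulr_suml.
by apply: eq_bigr => i _; rewrite coefMX/= bopZAl exprSr.
Qed.

Lemma cpoly_opM p q A : cpoly_op (p * q) A = cpoly_op p A * cpoly_op q A.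
Proof.
elim/poly_ind: q => [|q c IH].
  by rewrite mulr0 -(scale0r (0 : {poly _})) cpoly_opZ !scale0r mulr0.
rewrite mulrDr mulrA [_ * c%:P]mulrC mul_polyC !cpoly_opD !cpoly_opMX IH.
by rewrite cpoly_opZ cpoly_opC mulrDr bopZAr mulr1 mulrA.
Qed.

Lemma cpoly_opX A : cpoly_op 'X A = A.
Proof. by rewrite -['X]mul1r cpoly_opMX cpoly_opC scale1r mul1r. Qed.

(** [p(A)] is a nonzero scalar times the product of the A - z over the roots z; were each factor
    invertible, so would be the product. *)
Lemma cpoly_op_spectrum p A : p != 0 -> ~ invertible_op (cpoly_op p A) ->
  exists2 z, root p z & spectrum A z.
Proof.
have [r pr] := closed_field_poly_normal p.
rewrite pr scaler_eq0 lead_coef_eq0 negb_or => /andP[p0 _] np.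
apply: contrapT => nz; apply: np; rewrite cpoly_opZ.
have iZ c B : c != 0 -> invertible_op B -> invertible_op (c *: B).
  move=> c0 [C [h1 h2]]; exists (c^-1 *: C).
  by split; rewrite bopZAl bopZAr scalerA ?mulfV ?mulVf// scale1r ?h1 ?h2.
apply: iZ; first by rewrite lead_coef_eq0.
have {}nz z : z \in r -> invertible_op (A - z *: (1 : 'B(H))).
  move=> zr; apply: contrapT => sz; apply: nz; exists z => //.
  by rewrite rootZ ?lead_coef_eq0// root_prod_XsubC.
elim: r nz {pr} => [|z r IH] nz.
  by rewrite big_nil cpoly_opC scale1r; exists 1; split; rewrite mulr1.
rewrite big_cons cpoly_opM; apply: invertible_mul; last first.
  by apply: IH => y yr; apply: nz; rewrite inE yr orbT.
rewrite cpoly_opD cpoly_opX -scaleN1r cpoly_opZ cpoly_opC scaleN1r.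
by apply: nz; rewrite inE eqxx.
Qed.

Lemma poly_opE (p : {poly R}) A : poly_op p A = cpoly_op (map_poly (real_complex R) p) A.
Proof.
by rewrite /cpoly_op size_map_poly; apply: eq_bigr => i _; rewrite coef_map.
Qed.

Lemma poly_opD p q A : poly_op (p + q) A = poly_op p A + poly_op q A.
Proof. by rewrite !poly_opE rmorphD cpoly_opD. Qed.
Lemma poly_opM p q A : poly_op (p * q) A = poly_op p A * poly_op q A.
Proof. by rewrite !poly_opE rmorphM cpoly_opM. Qed.
Lemma poly_opC (c : R) A : poly_op c%:P A = scalar_op c.
Proof. by rewrite poly_opE map_polyC cpoly_opC. Qed.
Lemma poly_opX A : poly_op 'X A = A.
Proof. by rewrite poly_opE map_polyX cpoly_opX. Qed.
Lemma poly_opB p q A : poly_op (p - q) A = poly_op p A - poly_op q A.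
Proof. by rewrite !poly_opE rmorphB/= cpoly_opD -scaleN1r cpoly_opZ scaleN1r. Qed.

Lemma poly_opCA p A : A * poly_op p A = poly_op p A * A.
Proof. by rewrite -{1 4}[A]poly_opX -!poly_opM mulrC. Qed.

Lemma self_adjoint_poly p A : self_adjoint A -> self_adjoint (poly_op p A).
Proof.
move=> sA; elim/poly_ind: p => [|p c IH].
  by rewrite -polyC0 poly_opC; exact: self_adjoint_scalar.
rewrite poly_opD poly_opM poly_opC poly_opX.
apply: self_adjointD; last exact: self_adjoint_scalar.
by apply: self_adjointM => //; rewrite poly_opCA.
Qed.

(** The operator norm as the infimum of all bounds: it is itself a bound, and the last clause says
    that nothing smaller is one. *)
Lemma opnorm_attained A : exists N, [/\ 0 <= N, opnorm_le A N &
  forall k, 0 <= k < N -> exists x, k * rnorm x < rnorm (A x)].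
Proof.
pose E := [set k | 0 <= k /\ opnorm_le A k]%classic.
have [k0 k00 hk0] := opnorm_bound A.
have E0 : has_inf E.
  by split; [exists k0; split => //; exact: ltW|exists 0 => k []].
exists (inf E); split.
- by apply: lb_le_inf; [exact: E0.1|move=> k []].
- apply/opnorm_leP => x; apply/ler_addgt0Pl => e e0.
  have x0 : 0 < rnorm x + 1 by rewrite ltr_wpDl// rnorm_ge0.
  have [k [_ /opnorm_leP /(_ x) hk] kE] := inf_adherent (divr_gt0 e0 x0) E0.
  apply: (le_trans hk); apply: (le_trans (ler_wpM2r (rnorm_ge0 _) (ltW kE))).
  rewrite mulrDl addrC lerD2r mulrAC ler_pdivrMr//.
  by rewrite ler_wpM2l ?lerDl// ltW.
- move=> k /andP[k1 kE]; apply: contrapT => /forallNP nx.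
  suff : inf E <= k by rewrite leNgt kE.
  apply: ge_inf; first exact: E0.2.
  by split => //; apply/opnorm_leP => x; rewrite leNgt; apply/negP; exact: nx.
Qed.

(* A unit vector that almost attains the norm N of T is an approximate
   eigenvector of T ^+ 2 for N ^+ 2. *)
Lemma opnorm_sqr_spectrum A N : self_adjoint A -> 0 < N -> opnorm_le A N ->
  (forall k, 0 <= k < N -> exists x, k * rnorm x < rnorm (A x)) ->
  ~ invertible_op (A * A - scalar_op (N ^+ 2)).
Proof.
move=> /self_adjointP sA N0 hN hk [V [_ VA]].
have [v v0 /opnorm_leP hv] := opnorm_bound V.
(* With k^2 = N^2 (1 - 1/d), a vector beating [k] satisfies |x|^2 <= v^2 N^4 |x|^2 / d, that is d <=
   v^2 N^4; this [d] is just too large for that. *)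
pose d := 1 + v ^+ 2 * N ^+ 4; have d1 : 1 <= d.
  by rewrite lerDl mulr_ge0// ?sqr_ge0// exprn_ge0// ltW.
have d0 : 0 < d by rewrite (lt_le_trans ltr01).
have dV1 : d^-1 <= 1 by rewrite invf_le1.
have dV0 : 0 < d^-1 by rewrite invr_gt0.
pose k := N * Num.sqrt (1 - d^-1).
have k0 : 0 <= k by rewrite mulr_ge0 ?sqrtr_ge0// ltW.
have k2 : k ^+ 2 = N ^+ 2 * (1 - d^-1) by rewrite exprMn sqr_sqrtr// subr_ge0.
have [x kx] : exists x, k * rnorm x < rnorm (A x).
  apply: hk; rewrite k0/= -(@ltr_pXn2r _ 2)// ?nnegrE 1?ltW// k2.
  by rewrite gtr_pMr ?exprn_gt0//; lra.
have x0 : 0 < rnorm x.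
  rewrite rnorm_gt0; apply: contraTneq kx => ->.
  by rewrite linear0 rnorm0 mulr0 ltxx.
have kx2 : k ^+ 2 * rnorm x ^+ 2 <= rnorm (A x) ^+ 2.
  rewrite -exprMn; apply: ler_sqr_ge0; last exact: ltW.
  exact: mulr_ge0 (rnorm_ge0 _).
have h1 : rnorm x ^+ 2 <= v ^+ 2 * rnorm ((A * A - scalar_op (N ^+ 2)) x) ^+ 2.
  rewrite -exprMn ler_sqr_ge0 ?rnorm_ge0//.
  by have := hv ((A * A - scalar_op (N ^+ 2)) x); rewrite -bopME VA.
have h2 : rnorm ((A * A - scalar_op (N ^+ 2)) x) ^+ 2 <=
    N ^+ 2 * (N ^+ 2 * rnorm x ^+ 2 - rnorm (A x) ^+ 2).
  rewrite !bopE rnormB_sqr ipZr rnormZ exprMn sA ipii ger0_norm ?sqr_ge0//.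
  have : rnorm (A (A x)) ^+ 2 <= N ^+ 2 * rnorm (A x) ^+ 2.
    rewrite -exprMn ler_sqr_ge0 ?rnorm_ge0//.
    by move/opnorm_leP : hN; apply.
  by lra.
have h3 : N ^+ 2 * (N ^+ 2 * rnorm x ^+ 2 - rnorm (A x) ^+ 2) <=
    N ^+ 4 * d^-1 * rnorm x ^+ 2.
  apply: (@le_trans _ _ (N ^+ 2 * (N ^+ 2 * rnorm x ^+ 2 - k ^+ 2 * rnorm x ^+ 2))).
    by rewrite ler_wpM2l ?sqr_ge0// lerB.
  by rewrite k2 le_eqVlt; apply/orP; left; apply/eqP; ring.
have := le_trans h1 (ler_wpM2l (sqr_ge0 v) (le_trans h2 h3)).
rewrite mulrA -[leLHS]mul1r ler_pM2r ?exprn_gt0// mulrA ler_pdivlMr// mul1r /d.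
by rewrite -subr_ge0; lra.
Qed.

Lemma poly_op_norm p A e : self_adjoint A -> 0 <= e ->
  (forall t : R, spectrum A t%:C -> `|p.[t]| <= e) -> opnorm_le (poly_op p A) e.
Proof.
move=> sA e0 pe; set T := poly_op p A.
have [N [N0 hN hk]] := opnorm_attained T.
have [|eN] := leP N e; first by move/opnorm_leW; apply.
have NN : 0 < N by exact: le_lt_trans eN.
have sT : self_adjoint T by exact: self_adjoint_poly.
have := opnorm_sqr_spectrum sT NN hN hk.
have root_spec q : q != 0 -> ~ invertible_op (poly_op q A) ->
    exists2 t : R, root q t & spectrum A t%:C.
  rewrite poly_opE => q0 /cpoly_op_spectrum; rewrite map_poly_eq0 => /(_ q0)[z rz Az].
  exists (complex.Re z); last by rewrite -(spectrum_real sA Az).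
  by rewrite (spectrum_real sA Az) fmorph_root in rz.
have -> : T * T - scalar_op (N ^+ 2) = poly_op (p * p - (N ^+ 2)%:P) A.
  by rewrite poly_opB poly_opM poly_opC.
have contra t : spectrum A t%:C -> p.[t] * p.[t] <> N ^+ 2.
  move=> /pe /(ler_sqr_ge0 (normr_ge0 _)); rewrite real_normK ?num_real// -expr2 => pe2 pN.
  by move: pe2; rewrite pN leNgt ltr_pXn2r ?nnegrE// eN.
have [q0|q0] := eqVneq (p * p - (N ^+ 2)%:P) 0; last first.
  move=> /(root_spec _ q0)[t]; rewrite /root !hornerE subr_eq0 => /eqP pN At.
  by case: (contra _ At).
have allN t : p.[t] * p.[t] = N ^+ 2.
  have := congr1 (horner^~ t) q0; rewrite !hornerE /= => /eqP.
  by rewrite subr_eq0 => /eqP.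
(* Here p^2 is the constant N^2 and has no useful roots, but any spectral point at all contradicts
   [contra]. One is found by running the norm argument on [A] itself, whose polynomial X^2 - K^2 is
   not zero. *)
suff [t At] : exists t : R, spectrum A t%:C by case: (contra _ At).
have [Tx Txn] : exists x, 0 < rnorm (T x).
  by have [|x] := hk 0; rewrite ?lexx// mul0r => ?; exists x.
have [K [K0 hK hkK]] := opnorm_attained A.
have [K00|KN0] := eqVneq K 0.
  (* A zero operator is not invertible unless the space is zero, and [Txn] excludes the zero
     space. *)
  exists 0 => -[V [hV _]].
  have A0 : A = 0.
    apply: bop_eqP => x; apply/eqP; rewrite -rnorm_eq0 eq_le rnorm_ge0 andbT.
    by have /opnorm_leP/(_ x) := hK; rewrite K00 mul0r.
  move: Txn; rewrite -[T]mulr1 -hV A0 scale0r subr0 mul0r mulr0 bopE rnorm0.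
  by rewrite ltxx.
have {}K0 : 0 < K by rewrite lt_def KN0.
have := opnorm_sqr_spectrum sA K0 hK hkK.
have -> : A * A - scalar_op (K ^+ 2) = poly_op ('X ^+ 2 - (K ^+ 2)%:P) A.
  by rewrite poly_opB expr2 poly_opM poly_opC poly_opX.
move=> /root_spec[|t _ At]; last by exists t.
by rewrite -size_poly_eq0 size_XnsubC.
Qed.

End PolynomialCalculus.

(** * Weierstrass approximation *)

Section Weierstrass.
Local Open Scope classical_set_scope.
Local Open Scope ring_scope.
Context {R : realType}.
Implicit Types (f : R -> R) (a b e t x : R) (u v : nat -> R).

(** Compactness in its near-covering form: a radius that works near each point, for all small enough
    radii, yields one radius that works at all points. *)
Lemma heine_cantor a b f : {within `[a, b], continuous f} ->
  forall e, 0 < e -> exists2 d, 0 < d & forall s t, a <= s <= b -> a <= t <= b ->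
    `|s - t| <= d -> `|f s - f t| <= e.
Proof.
move=> /subspace_continuousP fc e e0.
have e20 : 0 < e / 2 by rewrite divr_gt0.
pose P d t := a <= t <= b -> forall s, a <= s <= b -> `|s - t| <= d -> `|f s - f t| <= e.
have /compact_near_coveringP/(_ _ 0^'+ P) := @segment_compact R a b.
case.
  move=> x /= xab.
  have /cvgrPdist_le/(_ _ e20) := fc x xab.
  move=> /nbhs_ballP[d /= d0 hd].
  have hd' s : `|x - s| < d -> a <= s <= b -> `|f x - f s| <= e / 2.
    by move=> xs sab; apply: hd.
  exists (ball x (d / 2), [set r | 0 < r < d / 2]).
    split => /=; first by apply: nbhsx_ballx; rewrite divr_gt0.
    exists (d / 2) => /=; first by rewrite divr_gt0.
    by move=> r /=; rewrite sub0r normrN => rd r0; rewrite r0 (le_lt_trans (ler_norm r)).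
  move=> [t r] /= [xt /andP[r0 rd]] tab s sab st.
  rewrite /ball /= in xt.
  rewrite (le_trans (ler_distD (f x) _ _))// [e]splitr lerD//.
    rewrite distrC; apply: hd' => //.
    rewrite (le_lt_trans (ler_distD t _ _))// [d]splitr ltrD// distrC.
    exact: le_lt_trans rd.
  by apply: hd' => //; rewrite (lt_trans xt)// ltr_pdivrMr// ltr_pMr ?ltr1n.
move=> d /= d0 hd; exists (d / 2); first by rewrite divr_gt0.
move=> s t sab tab st; apply: (hd (d / 2)) => //=.
- by rewrite sub0r normrN gtr0_norm ?divr_gt0// ltr_pdivrMr// ltr_pMr ?ltr1n.
- by rewrite divr_gt0.
Qed.

(* The value at x is the expectation of u (S_n), S_n binomial with parameters n and x. *)
Fixpoint bernstein n u : {poly R} :=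
  if n is n'.+1 then
    'X * bernstein n' (fun k => u k.+1) + (1 - 'X) * bernstein n' u
  else (u 0%N)%:P.

Lemma bernstein_le n u v x : 0 <= x <= 1 -> (forall k, (k <= n)%N -> u k <= v k) ->
  (bernstein n u).[x] <= (bernstein n v).[x].
Proof.
move=> x01; elim: n u v => [|n IH] u v uv /=; first by rewrite !hornerC uv.
rewrite !hornerE lerD// ler_wpM2l//; try lra; apply: IH => k kn; apply: uv => //.
exact: leqW.
Qed.

Lemma bernstein_affine n u x a b :
  (bernstein n (fun k => a + b * u k)).[x] = a + b * (bernstein n u).[x].
Proof.
elim: n u => [|n IH] u /=; first by rewrite !hornerC.
by rewrite !hornerE !IH; ring.
Qed.

(** Squared bias plus the binomial variance n x (1 - x). The centre [a] is arbitrary because the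
    induction shifts it by one. *)
Lemma bernstein_sqr n x a :
  (bernstein n (fun k => (k%:R - a) ^+ 2)).[x] = (n%:R * x - a) ^+ 2 + n%:R * x * (1 - x).
Proof.
elim: n a => [|n IH] a /=; first by rewrite !hornerC; ring.
have -> : (fun k => (k.+1%:R - a) ^+ 2) = (fun k => (k%:R - (a - 1)) ^+ 2).
  by apply/funext => k; rewrite -natr1; ring.
by rewrite !hornerE !IH -natr1; ring.
Qed.

Lemma weierstrass a b f : a < b -> {within `[a, b], continuous f} ->
  forall e, 0 < e -> exists p : {poly R}, forall t, a <= t <= b -> `|f t - p.[t]| <= e.
Proof.
move=> ab fc e e0; have e20 : 0 < e / 2 by rewrite divr_gt0.
have [d d0 hd] := heine_cantor fc e20.
have [K K0 hK] : exists2 K, 0 < K & forall s t, a <= s <= b -> a <= t <= b -> f s - f t <= K.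
  have [c1 _ h1] := EVT_max (ltW ab) fc; have [c2 _ h2] := EVT_min (ltW ab) fc.
  exists (`|f c1 - f c2| + 1); first by rewrite ltr_wpDl.
  move=> s t sab tab; have := h1 s; have := h2 t; rewrite !in_itv/= => /(_ tab) ? /(_ sab) ?.
  have := ler_norm (f c1 - f c2); lra.
(* A quadratic majorant: nearby points are covered by the modulus of continuity, and distant ones by
   the oscillation [K], since there (s - t)^2 / d^2 >= 1. Taking expectations leaves only a variance
   to estimate. *)
have hf s t : a <= s <= b -> a <= t <= b -> f s - f t <= e / 2 + K / d ^+ 2 * (s - t) ^+ 2.
  move=> sab tab; have [st|st] := leP `|s - t| d.
    rewrite (le_trans (ler_norm _))// (le_trans (hd _ _ sab tab st))// lerDl.
    by rewrite mulr_ge0// ?sqr_ge0// divr_ge0 ?sqr_ge0// ltW.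
  rewrite (le_trans (hK _ _ sab tab))// ler_wpDl ?(ltW e20)//.
  rewrite mulrAC ler_pdivlMr ?exprn_gt0// ler_wpM2l ?(ltW K0)//.
  by rewrite -[leRHS]real_normK ?num_real// ler_sqr_ge0// ltW.
(* The nodes [g k] have variance at most (b - a)^2 / N, so c / N bounds the expected quadratic
   term. *)
pose c := K / d ^+ 2 * (b - a) ^+ 2.
have c0 : 0 < c by rewrite mulr_gt0// ?divr_gt0// exprn_gt0// subr_gt0.
have [n cn] : exists n : nat, c / n.+1%:R <= e / 2.
  exists (Num.truncn (c / (e / 2))).
  rewrite ler_pdivrMr// mulrC -ler_pdivrMr// ltW//; exact: truncnS_gt.
pose N : R := n.+1%:R; have N0 : 0 < N by rewrite ltr0n.
have N1 : 1 + n%:R != 0 :> R by rewrite addrC natr1 pnatr_eq0.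
pose g k := a + (b - a) * (k%:R / N).
pose x t := (b - a)^-1 * (t - a).
(* Composition with the affine map carrying [a, b] onto [0, 1]. *)
exists (bernstein n.+1 (f \o g) \Po ((b - a)^-1 *: ('X - a%:P))) => t tab.
have -> : (bernstein n.+1 (f \o g) \Po ((b - a)^-1 *: ('X - a%:P))).[t] =
    (bernstein n.+1 (f \o g)).[x t] by rewrite horner_comp !hornerE.
have ba0 : 0 < b - a by rewrite subr_gt0.
have x01 : 0 <= x t <= 1.
  by rewrite /x mulrC ler_pdivlMr// ler_pdivrMr//; lra.
have gab k : (k <= n.+1)%N -> a <= g k <= b.
  move=> kn; have k0 : 0 <= k%:R / N by rewrite divr_ge0// ltW.
  have k1 : k%:R / N <= 1 by rewrite ler_pdivrMr// mul1r ler_nat.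
  rewrite /g; apply/andP; split; first by rewrite lerDl mulr_ge0// ltW.
  by rewrite addrC -lerBrDr ler_piMr// ltW.
have gt k : (g k - t) ^+ 2 = ((b - a) / N) ^+ 2 * (k%:R - N * x t) ^+ 2.
  rewrite -exprMn; congr (_ ^+ 2); rewrite /g /x; field.
  by rewrite N1 gt_eqF.
pose C := K / d ^+ 2 * ((b - a) / N) ^+ 2.
have Cb : C * (N * x t * (1 - x t)) <= e / 2.
  apply: le_trans cn; have -> : C * (N * x t * (1 - x t)) = c / N * (x t * (1 - x t)).
    by rewrite /C /c; field; rewrite N1 gt_eqF.
  by rewrite ler_piMr ?divr_ge0 1?ltW//; nra.
have Eq0 : (bernstein n.+1 (fun k => (k%:R - N * x t) ^+ 2)).[x t] = N * x t * (1 - x t).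
  by rewrite bernstein_sqr -/N subrr expr0n add0r.
have up : (bernstein n.+1 (f \o g)).[x t] <= f t + e / 2 + C * (N * x t * (1 - x t)).
  rewrite -Eq0 -bernstein_affine; apply: bernstein_le => // k kn /=.
  by have := hf (g k) t (gab k kn) tab; rewrite gt mulrA -/C /=; move: (_ ^+ 2) => ? ?; lra.
have lo : f t - e / 2 + - C * (N * x t * (1 - x t)) <= (bernstein n.+1 (f \o g)).[x t].
  rewrite -Eq0 -bernstein_affine; apply: bernstein_le => // k kn /=.
  have := hf t (g k) tab (gab k kn); rewrite -[(t - g k) ^+ 2]sqrrN opprB gt mulrA -/C /=.
  by move: (_ ^+ 2) => ? ?; lra.
by rewrite ler_norml; lra.
Qed.

End Weierstrass.

(** Cauchy-Schwarz, from the nonnegative squared norms of |y| x - |x| y and |y| x + |x| y. *)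
Lemma ip_le_rnorm (R : realType) (H : hilbertType R) (x y : H) :
  `|ip x y| <= rnorm x * rnorm y.
Proof.
have [->|x0] := eqVneq x 0.
  by rewrite -(scale0r x) -[0]/((0 : R)%:C) ipZl rnormZ normr0 !mul0r normr0.
have [->|y0] := eqVneq y 0.
  by rewrite -(scale0r y) -[0]/((0 : R)%:C) ipZr rnormZ !(normr0, mul0r, mulr0).
have xy : 0 < rnorm x * rnorm y by rewrite mulr_gt0 ?rnorm_gt0.
have h1 := sqr_ge0 (rnorm ((rnorm y)%:C *: x - (rnorm x)%:C *: y)).
have h2 := sqr_ge0 (rnorm ((rnorm y)%:C *: x + (rnorm x)%:C *: y)).
move: h1 h2; rewrite rnormB_sqr rnormD_sqr !ipZl !ipZr !rnormZ.
rewrite (ger0_norm (rnorm_ge0 x)) (ger0_norm (rnorm_ge0 y)).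
by move=> h1 h2; rewrite ler_norml; apply/andP; split; rewrite -(ler_pM2l xy); lra.
Qed.

(** * Continuous functional calculus *)

Section FunctionalCalculus.
Context {R : realType}.
Local Open Scope classical_set_scope.
Local Open Scope ring_scope.

(** Two polynomials close to [f] on the spectrum are close to each other there, and [poly_op_norm]
    turns this into closeness of operators. *)
Lemma is_fun_calc_unique (H : hilbertType R) (A B C : 'B(H)) (f : R -> R) :
  self_adjoint A -> is_fun_calc f A B -> is_fun_calc f A C -> B = C.
Proof.
move=> sA hB hC; apply: opnorm_small_eq => e e0.
have e40 : 0 < e / 4 by rewrite divr_gt0.
have [p [pf pB]] := hB _ e40; have [q [qf qC]] := hC _ e40.
have pq : opnorm_le (poly_op p A - poly_op q A) (e / 4 + e / 4).
  rewrite -poly_opB; apply: poly_op_norm => // [|t At]; first by rewrite addr_ge0 ?ltW.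
  rewrite hornerD hornerN (le_trans (ler_distD (f t) _ _))// lerD ?qf//.
  by rewrite distrC pf.
apply: opnorm_leW (opnorm_le_dist (opnorm_le_dist (opnorm_leB pB) pq) qC).
lra.
Qed.

Lemma fun_calc_unique (H : hilbertType R) (A B : 'B(H)) (f : R -> R) :
  self_adjoint A -> is_fun_calc f A B -> fun_calc f A = B.
Proof.
move=> sA hB; apply: (is_fun_calc_unique (f := f) sA) => //.
by rewrite /fun_calc; case: xgetP => [C _ //|/(_ B)].
Qed.

Section Interval.
Context {H : hilbertType R}.
Variables (a b : R) (A : 'B(H)).
Hypotheses (ab : a < b) (aA : scalar_op a ⪯ A) (Ab : A ⪯ scalar_op b).
Implicit Types (f g : R -> R) (p q : {poly R}) (e : R) (B : 'B(H)).

(** Closeness on an interval containing the spectrum, where [weierstrass] applies, instead of on the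
    spectrum itself. *)
Local Notation close f p e := (forall t : R, a <= t <= b -> `|f t - p.[t]| <= e).

Let sA : self_adjoint A := loewner_self_adjoint aA.

Lemma spectrum_itv t : spectrum A t%:C -> a <= t <= b.
Proof. by move=> /(spectrum_bounds aA Ab)[s ? /complexI ->]. Qed.

Lemma poly_op_dist f p q e e' : close f p e -> close f q e' ->
  opnorm_le (poly_op p A - poly_op q A) (e + e').
Proof.
move=> fp fq; rewrite -poly_opB.
have tri t : a <= t <= b -> `|(p - q).[t]| <= e + e'.
  move=> tab; rewrite hornerD hornerN (le_trans (ler_distD (f t) _ _))//.
  by rewrite lerD ?fq// distrC fp.
apply: poly_op_norm => // [|t At]; last by apply: tri; apply: spectrum_itv.
by apply: le_trans (tri a _); rewrite ?normr_ge0// lexx ltW.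
Qed.

(** Here the limit operator is shown to exist, so that [fun_calc] is not its default 0. The factor
    3: the distance from [p] to a late term of a fixed approximating sequence is at most 2 e, and
    that term is within e of the limit. *)
Lemma fun_calc_approx f : {within `[a, b], continuous f} ->
  forall p e, 0 < e -> close f p e -> opnorm_le (poly_op p A - fun_calc f A) (3 * e).
Proof.
move=> fc.
have [q hq] := choice (fun n : nat => weierstrass ab fc (divr_gt0 ltr01 (ltr0Sn R n))).
have inv_small e : 0 < e -> exists N, forall n, (N <= n)%N -> 1 / n.+1%:R <= e.
  move=> e0; exists (Num.truncn e^-1) => n Nn.
  rewrite div1r -[leRHS]invrK lef_pV2 ?posrE ?invr_gt0//.
  by rewrite ltW// (lt_le_trans (truncnS_gt _))// ler_nat.
have [|B hB] := @opnorm_cauchy_cvg R H (fun n => poly_op (q n) A).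
  move=> e e0; have [N hN] := inv_small _ (divr_gt0 e0 (ltr0n _ 2)).
  exists N => n Nn; apply: opnorm_leW (poly_op_dist (hq N) (hq n)).
  by rewrite [e]splitr lerD// hN.
have pB p e : 0 < e -> close f p e -> opnorm_le (poly_op p A - B) (3 * e).
  move=> e0 fp; have [N hN] := inv_small _ e0; have [M hM] := hB _ e0.
  have h1 := poly_op_dist fp (hq (maxn N M)).
  apply: opnorm_leW (opnorm_le_dist h1 (hM _ (leq_maxr _ _))).
  by move: (hN _ (leq_maxl N M)); set r := 1 / _ => r_le; lra.
rewrite (@fun_calc_unique H A B f)// => e e0.
have e30 : 0 < e / 3 by rewrite divr_gt0.
have [p fp] := weierstrass ab fc e30; exists p; split.
  by move=> t /spectrum_itv tab; rewrite (le_trans (fp t tab))//; lra.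
by apply: opnorm_leW (pB _ _ e30 fp); lra.
Qed.

(** The tool for identifying values of the calculus; [k] absorbs whatever constant the approximation
    costs. *)
Lemma fun_calc_eq f B k : {within `[a, b], continuous f} ->
  (forall e, 0 < e -> exists2 p, close f p e & opnorm_le (poly_op p A - B) (k * e)) ->
  fun_calc f A = B.
Proof.
move=> fc h; apply: opnorm_small_eq => e e0.
have k0 : 0 < `|k| + 3 by rewrite ltr_wpDl.
have [p fp pB] := h _ (divr_gt0 e0 k0).
have := opnorm_le_dist (opnorm_leB (fun_calc_approx fc (divr_gt0 e0 k0) fp)) pB.
apply: opnorm_leW; rewrite -mulrDl mulrA ler_pdivrMr// mulrC ler_wpM2l ?(ltW e0)//.
by have := ler_norm k; lra.
Qed.

Lemma eq_in_fun_calc f g : {within `[a, b], continuous f} ->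
  {within `[a, b], continuous g} ->
  (forall t, a <= t <= b -> f t = g t) -> fun_calc f A = fun_calc g A.
Proof.
move=> fc gc fg; apply: (@fun_calc_eq _ _ 3) => // e e0.
have [p gp] := weierstrass ab gc e0; exists p; last exact: fun_calc_approx.
by move=> t tab; rewrite fg// gp.
Qed.

Lemma fun_calc_id : fun_calc id A = A.
Proof.
apply: (@fun_calc_eq _ _ 0) => [|e e0]; first by apply: continuous_subspaceT => t; exact: cvg_id.
exists 'X => [t _|]; first by rewrite hornerX subrr normr0 ltW.
by rewrite poly_opX subrr mul0r; apply: opnorm_le0.
Qed.

Lemma fun_calc_cst (c : R) : fun_calc (fun=> c) A = scalar_op c.
Proof.
apply: (@fun_calc_eq _ _ 0) => [|e e0]; first exact/continuous_subspaceT/cst_continuous.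
exists c%:P => [t _|]; first by rewrite hornerC subrr normr0 ltW.
by rewrite poly_opC subrr mul0r; apply: opnorm_le0.
Qed.

Lemma within_continuousM f g : {within `[a, b], continuous f} ->
  {within `[a, b], continuous g} -> {within `[a, b], continuous (fun t => f t * g t)}.
Proof. by move=> fc gc t; apply: cvgM; [exact: fc|exact: gc]. Qed.

Lemma within_bounded f : {within `[a, b], continuous f} ->
  exists2 k, 0 < k & forall t, a <= t <= b -> `|f t| <= k.
Proof.
move=> fc; have [c1 _ h1] := EVT_max (ltW ab) fc; have [c2 _ h2] := EVT_min (ltW ab) fc.
exists (`|f c1| + `|f c2| + 1); first by rewrite ltr_wpDl// addr_ge0.
move=> t tab; have := h1 t; have := h2 t; rewrite !in_itv/= => /(_ tab) ? /(_ tab) ?.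
have ? := ler_norm (f c1); have := ler_norm (- f c2); rewrite normrN => ?.
have ? := normr_ge0 (f c1); have ? := normr_ge0 (f c2).
by rewrite ler_norml; lra.
Qed.

Lemma fun_calcM f g : {within `[a, b], continuous f} -> {within `[a, b], continuous g} ->
  fun_calc (fun t => f t * g t) A = fun_calc f A * fun_calc g A.
Proof.
move=> fc gc; have [F F0 hF] := within_bounded fc; have [G G0 hG] := within_bounded gc.
have [K K0 hK] := opnorm_bound (fun_calc g A).
apply: opnorm_small_eq => e e0.
(* One summand for each error: p q against f g, then p(A) (q(A) - g(A)), then (p(A) - f(A)) g(A).
   The bound d <= 1 gives |p| <= F + 1 on the interval. *)
pose L := 3 * (F + G + 1) + 3 * (F + 1) + 3 * K.
have L0 : 0 < L by rewrite /L; lra.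
pose d := Num.min 1 (e / L).
have [d0 d1 dL] : [/\ 0 < d, d <= 1 & L * d <= e].
  rewrite /d lt_min ltr01 divr_gt0// ge_min lexx; split => //.
  by rewrite mulrC -ler_pdivlMr// ge_min lexx orbT.
have [p fp] := weierstrass ab fc d0; have [q gq] := weierstrass ab gc d0.
have hp t : a <= t <= b -> `|p.[t]| <= F + 1.
  move=> tab; have := fp t tab; have := hF t tab => ? ?.
  by rewrite -[p.[t]](subKr (f t)) (le_trans (ler_normB _ _))//; lra.
have pq : close (fun t => f t * g t) (p * q) (d * (F + G + 1)).
  move=> t tab; rewrite hornerM.
  have -> : f t * g t - p.[t] * q.[t] = (f t - p.[t]) * g t + p.[t] * (g t - q.[t]) by ring.
  rewrite (le_trans (ler_normD _ _))// !normrM.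
  have -> : d * (F + G + 1) = d * G + (F + 1) * d by ring.
  by rewrite lerD// ler_pM// ?fp ?hG ?hp ?gq.
have pA : opnorm_le (poly_op p A) (F + 1).
  apply: poly_op_norm => // [|t /spectrum_itv]; last exact: hp.
  by lra.
have h1 : opnorm_le (fun_calc (fun t => f t * g t) A - poly_op (p * q) A)
    (3 * (d * (F + G + 1))).
  apply/opnorm_leB/fun_calc_approx => //; first exact: within_continuousM.
  by rewrite mulr_gt0//; lra.
have h2 : opnorm_le (poly_op p A * (poly_op q A - fun_calc g A)) ((F + 1) * (3 * d)).
  by apply: opnorm_leM => //; [lra|exact: fun_calc_approx].
have h3 : opnorm_le ((poly_op p A - fun_calc f A) * fun_calc g A) (3 * d * K).
  by apply: opnorm_leM => //; [lra|exact: fun_calc_approx].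
have := opnorm_leD h1 (opnorm_leD h2 h3).
rewrite mulrBr mulrBl [X in opnorm_le (_ + X)]addrA subrK -poly_opM addrA subrK.
by apply: opnorm_leW; apply: le_trans dL; rewrite /L; lra.
Qed.

Lemma self_adjoint_fun_calc f : {within `[a, b], continuous f} ->
  self_adjoint (fun_calc f A).
Proof.
move=> fc; apply/self_adjointP => x y; apply/eqP; rewrite -subr_eq0 -normr_le0.
apply/ler_addgt0Pl => e e0; rewrite addr0.
pose L := 6 * (rnorm x * rnorm y) + 1.
have L0 : 0 < L by rewrite ltr_wpDl// mulr_ge0// mulr_ge0 ?rnorm_ge0.
have d0 : 0 < e / L by rewrite divr_gt0.
have [p fp] := weierstrass ab fc d0.
have /opnorm_leP hp := fun_calc_approx fc d0 fp.
set P := poly_op p A in hp; set F := fun_calc f A in hp *.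
have -> : ip (F x) y - ip x (F y) = ip x ((P - F) y) - ip ((P - F) x) y.
  rewrite !bopE ipBl ipBr (_ : ip (P x) y = ip x (P y)); first by ring.
  by rewrite /ip (self_adjoint_poly p sA).
rewrite (le_trans (ler_normB _ _))//.
have h1 : `|ip x ((P - F) y)| <= rnorm x * (3 * (e / L) * rnorm y).
  by rewrite (le_trans (ip_le_rnorm _ _))// ler_wpM2l ?rnorm_ge0.
have h2 : `|ip ((P - F) x) y| <= 3 * (e / L) * rnorm x * rnorm y.
  by rewrite (le_trans (ip_le_rnorm _ _))// ler_wpM2r ?rnorm_ge0.
rewrite (le_trans (lerD h1 h2))//.
have -> : rnorm x * (3 * (e / L) * rnorm y) + 3 * (e / L) * rnorm x * rnorm y =
    (L - 1) * (e / L) by rewrite /L; ring.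
by rewrite mulrBl mul1r mulrC divfK ?gt_eqF// gerBl ltW.
Qed.

(** [f] is the square of the continuous function sqrt f, so f(A) is the square of a self-adjoint
    operator. *)
Lemma positive_fun_calc f : {within `[a, b], continuous f} ->
  (forall t, a <= t <= b -> 0 <= f t) -> positive_op (fun_calc f A).
Proof.
move=> fc f0; pose h t := Num.sqrt (f t).
have hc : {within `[a, b], continuous h}.
  by move=> t; apply: (cvg_comp f Num.sqrt); [exact: fc|exact: sqrt_continuous].
rewrite (_ : fun_calc f A = fun_calc h A * fun_calc h A).
  exact/positive_sqr/self_adjoint_fun_calc.
rewrite -fun_calcM//; apply: eq_in_fun_calc => //; first exact: within_continuousM.
by move=> t tab; rewrite -expr2 sqr_sqrtr ?f0.
Qed.

End Interval.

Lemma fun_calc_scalar (H : hilbertType R) (f : R -> R) (c : R) :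
  fun_calc f (scalar_op c) = scalar_op (f c) :> 'B(H).
Proof.
have sc : self_adjoint (scalar_op c : 'B(H)) by exact: self_adjoint_scalar.
have cc : (scalar_op c : 'B(H)) ⪯ scalar_op c.
  by rewrite /loewner_le subrr => x; rewrite bopE linear0l.
apply: fun_calc_unique => // e e0; exists (f c)%:P; split.
  move=> t /(spectrum_itv cc cc); rewrite -eq_le => /eqP <-.
  by rewrite hornerC subrr normr0 ltW.
by rewrite poly_opC subrr; apply/opnorm_le0/ltW.
Qed.

(** The order is closed under norm limits of the upper bound; this is how d tends to 0 in
    [operator_concave]. *)
Lemma loewner_approx (H : hilbertType R) (A B : 'B(H)) : self_adjoint A -> self_adjoint B ->
  (forall e, 0 < e -> exists2 C, self_adjoint C /\ A ⪯ C & opnorm_le (C - B) e) -> A ⪯ B.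
Proof.
move=> sA sB h; apply/loewner_leP => // x; apply/ler_addgt0Pl => e e0.
have x0 : 0 < rnorm x ^+ 2 + 1 by rewrite ltr_wpDl// sqr_ge0.
have d0 : 0 < e / (rnorm x ^+ 2 + 1) by rewrite divr_gt0.
have [C [sC AC] CB] := h _ d0.
have := ip_le_opnorm x d0 CB; have /loewner_leP/(_ x) := AC => /(_ sA sC) h1.
rewrite bopBE ipBl => /(le_trans (ler_norm _)) h2.
have h3 : e / (rnorm x ^+ 2 + 1) * rnorm x ^+ 2 <= e.
  by rewrite mulrAC ler_pdivrMr// ler_wpM2l ?lerDl// ltW.
by lra.
Qed.

End FunctionalCalculus.

(** A separate name, because the norm attached to pairs is the maximum and an inner product needs
    the Euclidean one. *)
Definition hsum {R : realType} (H : hilbertType R) : Type := (H * H)%type.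

(** * The Hilbert space H (+) H *)

Section HilbertSum.
Context {R : realType} (H : hilbertType R).
Implicit Types (z w : hsum H).
Local Open Scope classical_set_scope.
Local Open Scope ring_scope.

HB.instance Definition _ := GRing.Lmodule.copy (hsum H) (H * H)%type.

Let n z : R := Num.sqrt (rnorm z.1 ^+ 2 + rnorm z.2 ^+ 2).

Let n_ge0 z : 0 <= n z. Proof. exact: sqrtr_ge0. Qed.

Let n_sqr z : n z ^+ 2 = rnorm z.1 ^+ 2 + rnorm z.2 ^+ 2.
Proof. by rewrite sqr_sqrtr// addr_ge0// sqr_ge0. Qed.

Let ip_le_n z w : ip z.1 w.1 + ip z.2 w.2 <= n z * n w.
Proof.
have h1 := le_trans (ler_norm _) (ip_le_rnorm z.1 w.1).
have h2 := le_trans (ler_norm _) (ip_le_rnorm z.2 w.2).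
apply: (le_trans (lerD h1 h2)).
rewrite -(@ler_pXn2r _ 2)// ?nnegrE ?addr_ge0 ?mulr_ge0 ?rnorm_ge0//.
rewrite exprMn !n_sqr -subr_ge0.
move: {h1 h2} (rnorm z.1) (rnorm w.1) (rnorm z.2) (rnorm w.2) => a b c d.
have -> : (a ^+ 2 + c ^+ 2) * (b ^+ 2 + d ^+ 2) - (a * b + c * d) ^+ 2 = (a * d - c * b) ^+ 2.
  by ring.
exact: sqr_ge0.
Qed.

Let n_triangle z w : n (z + w) <= n z + n w.
Proof.
rewrite -(@ler_pXn2r _ 2)// ?nnegrE ?addr_ge0//.
rewrite n_sqr /= !rnormD_sqr sqrrD !n_sqr.
by have := ip_le_n z w; rewrite -mulr_natl; lra.
Qed.

Let n_le z : n z <= rnorm z.1 + rnorm z.2.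
Proof.
rewrite -(@ler_pXn2r _ 2)// ?nnegrE ?addr_ge0 ?rnorm_ge0// n_sqr sqrrD.
by rewrite lerD2r lerDl mulrn_wge0// mulr_ge0// rnorm_ge0.
Qed.

Let le_n1 z : rnorm z.1 <= n z.
Proof. by rewrite -(@ler_pXn2r _ 2)// ?nnegrE ?rnorm_ge0// n_sqr lerDl sqr_ge0. Qed.

Let le_n2 z : rnorm z.2 <= n z.
Proof. by rewrite -(@ler_pXn2r _ 2)// ?nnegrE ?rnorm_ge0// n_sqr lerDr sqr_ge0. Qed.

Let norm z : R[i] := (n z)%:C.

Let normD z w : norm (z + w) <= norm z + norm w.
Proof. by rewrite /norm -rmorphD lecR. Qed.

Let normZ (l : R[i]) z : norm (l *: z) = `|l| * norm z.
Proof.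
have -> : `|l| = (complex.Re `|l|)%:C by rewrite RRe_real// normr_real.
rewrite /norm -rmorphM; congr (_%:C).
have l0 : 0 <= complex.Re `|l| by rewrite -ler0c RRe_real// normr_real.
rewrite /n /= !rnormZc !exprMn -mulrDr sqrtrM ?sqr_ge0// sqrtr_sqr.
by rewrite ger0_norm.
Qed.

Let norm_eq0 z : norm z = 0 -> z = 0.
Proof.
move=> /eqP; rewrite realC_eq0 => /eqP z0.
have z1 : rnorm z.1 = 0 by apply/eqP; rewrite eq_le rnorm_ge0 andbT -z0.
have z2 : rnorm z.2 = 0 by apply/eqP; rewrite eq_le rnorm_ge0 andbT -z0.
by apply/pair_eqP; rewrite /pair_eq -!rnorm_eq0 z1 z2 eqxx.
Qed.

HB.instance Definition _ := Lmodule_isNormed.Build R[i] (hsum H) normD normZ norm_eq0.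

Lemma hsum_normE z : `|z| = (Num.sqrt (rnorm z.1 ^+ 2 + rnorm z.2 ^+ 2))%:C.
Proof. by []. Qed.

(** Both projections are contractions, so they carry a Cauchy filter to Cauchy filters; [n_le]
    recombines the two limits. *)
Let complete (F : set_system (hsum H)) : ProperFilter F -> cauchy F -> cvg F.
Proof.
move=> FF /cauchyP Fc.
have cproj (g : hsum H -> H) : (forall z, rnorm (g z) <= n z) ->
    (forall z w, g (z - w) = g z - g w) -> cvg (g @ F).
  move=> gn gB; apply: cauchy_cvg; apply/cauchyP => e e0.
  have [z Fz] := Fc e e0; exists (g z).
  apply: (@filterS _ F _ (ball z e) (g @^-1` ball (g z) e)) => // w zw.
  have {}zw : `|z - w| < e by exact: zw.
  rewrite /= -ball_normE /=; apply: le_lt_trans zw.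
  by rewrite rnormE hsum_normE lecR -gB.
have /cvg_ex[l1 /= F1] : cvg ((fst : hsum H -> H) @ F) by exact: cproj.
have /cvg_ex[l2 /= F2] : cvg ((snd : hsum H -> H) @ F) by exact: cproj.
apply/cvg_ex; exists (l1, l2); apply/fcvgrPdist_lt => e e0.
have e20 : 0 < e / 2 by rewrite divr_gt0.
move/cvgrPdist_lt : F1 => /(_ _ e20) G1; move/cvgrPdist_lt : F2 => /(_ _ e20) G2.
near=> z.
have h1 : `|l1 - z.1| < e / 2 by near: z.
have h2 : `|l2 - z.2| < e / 2 by near: z.
rewrite [ltRHS]splitr; apply: le_lt_trans (ltrD h1 h2).
by rewrite hsum_normE !rnormE -rmorphD lecR; exact: n_le.
Unshelve. all: by end_near. Qed.

HB.instance Definition _ := Uniform_isComplete.Build (hsum H) complete.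

Definition hsum_dot z w : R[i] := hdot z.1 w.1 + hdot z.2 w.2.

Let dot_bilinear : bilinear_for ( *%R) (conjC \; *%R) hsum_dot.
Proof.
split=> w c z z' /=; rewrite /hsum_dot /=.
  by rewrite !hdotDl !hdotZl mulrDr addrACA.
by rewrite !hdotDr !hdotZr mulrDr addrACA.
Qed.

HB.instance Definition _ := @bilinear_isBilinear.Build R[i] (hsum H) (hsum H) R[i]
  ( *%R) (conjC \; *%R) hsum_dot dot_bilinear.

Let dot_herm z w : hsum_dot z w = (-1) ^+ false * conjC (hsum_dot w z).
Proof. by rewrite expr0 mul1r /hsum_dot rmorphD; congr (_ + _); exact: hdotC. Qed.

HB.instance Definition _ :=
  @isHermitianSesquilinear.Build R[i] (hsum H) false conjC hsum_dot dot_herm.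

Let dot_norm z : `|z| ^+ 2 = hsum_dot z z.
Proof.
by rewrite hsum_normE /hsum_dot -!hdot_norm !rnormE -!rmorphXn -rmorphD n_sqr.
Qed.

Let dot_gt0 z : z != 0 -> 0 < hsum_dot z z.
Proof. by move=> z0; rewrite -dot_norm exprn_gt0// normr_gt0. Qed.

HB.instance Definition _ := @isDotProduct.Build R[i] (hsum H) hsum_dot dot_gt0.

HB.instance Definition _ := @CompleteNormedModule_isHilbert.Build R (hsum H)
  (hsum_dot : {dot (hsum H) for conjC}) dot_norm.

End HilbertSum.

Section HsumTheory.
Context {R : realType} {H : hilbertType R}.

Lemma hsum_ip (z w : hsum H) : ip z w = ip z.1 w.1 + ip z.2 w.2.
Proof. by rewrite /ip -raddfD. Qed.

Lemma hsum_rnorm (z : hsum H) : rnorm z ^+ 2 = rnorm z.1 ^+ 2 + rnorm z.2 ^+ 2.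
Proof. by rewrite -!ipii hsum_ip. Qed.

End HsumTheory.

Section HsumOperators.
Context {R : realType} {H : hilbertType R}.
Implicit Types (X Y : 'B(H)) (z : hsum H) (u v : H).

Let half : R[i] := 2^-1.

Let halfE : half = (2^-1 : R)%:C.
Proof. exact: half_real. Qed.

Let half_sum u v : half *: (u + v) + half *: (u - v) = u.
Proof.
rewrite -scalerDr addrACA subrr addr0 -mulr2n -scaler_nat scalerA mulVf ?scale1r//.
by rewrite pnatr_eq0.
Qed.

Let half_diff u v : half *: (u + v) - half *: (u - v) = v.
Proof. by have := half_sum v u; rewrite -[v - u]opprB scalerN [v + u]addrC. Qed.

Let rnorm_hsum z : rnorm z <= rnorm z.1 + rnorm z.2.
Proof.
rewrite -(@ler_pXn2r _ 2)// ?nnegrE ?addr_ge0 ?rnorm_ge0// hsum_rnorm sqrrD.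
by rewrite lerD2r lerDl mulrn_wge0// mulr_ge0// rnorm_ge0.
Qed.

Let rnorm_fst z : rnorm z.1 <= rnorm z.
Proof. by rewrite -(@ler_pXn2r _ 2)// ?nnegrE ?rnorm_ge0// hsum_rnorm lerDl sqr_ge0. Qed.

Let rnorm_snd z : rnorm z.2 <= rnorm z.
Proof. by rewrite -(@ler_pXn2r _ 2)// ?nnegrE ?rnorm_ge0// hsum_rnorm lerDr sqr_ge0. Qed.

Definition diag_fun X Y z : hsum H := (X z.1, Y z.2).

Let diag_norm X Y k : 0 <= k -> opnorm_le X k -> opnorm_le Y k ->
  forall z, rnorm (diag_fun X Y z) <= 2 * k * rnorm z.
Proof.
move=> k0 /opnorm_leP hX /opnorm_leP hY z; rewrite (le_trans (rnorm_hsum _))//.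
have h1 := le_trans (hX z.1) (ler_wpM2l k0 (rnorm_fst z)).
have h2 := le_trans (hY z.2) (ler_wpM2l k0 (rnorm_snd z)).
by rewrite (le_trans (lerD h1 h2))// le_eqVlt; apply/orP; left; apply/eqP; ring.
Qed.

Fact diag_subproof X Y : diag_fun X Y \in @bounded_linear_pred R (hsum H).
Proof.
apply/mem_set; split; first by move=> c z w; congr pair; rewrite /= linearP.
have [k1 k10 h1] := opnorm_bound X; have [k2 k20 h2] := opnorm_bound Y.
exists (2 * (k1 + k2)) => z; rewrite !rnormE -rmorphM lecR.
apply: diag_norm; first by rewrite addr_ge0 1?ltW.
  by apply: opnorm_leW h1; rewrite lerDl ltW.
by apply: opnorm_leW h2; rewrite lerDr ltW.
Qed.

Definition diag_op X Y : 'B(hsum H) := Bop (diag_subproof X Y).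

(* The block matrix [[P, Q], [Q, P]] with P = (X + Y) / 2 and Q = (X - Y) / 2,
   unitarily equivalent to [diag_op X Y]. *)
Definition mix_fun X Y z : hsum H :=
  (half *: (X (z.1 + z.2) + Y (z.1 - z.2)), half *: (X (z.1 + z.2) - Y (z.1 - z.2))).

Let mix_norm X Y k : 0 <= k -> opnorm_le X k -> opnorm_le Y k ->
  forall z, rnorm (mix_fun X Y z) <= 4 * k * rnorm z.
Proof.
move=> k0 /opnorm_leP hX /opnorm_leP hY z; rewrite (le_trans (rnorm_hsum _))//=.
rewrite halfE !rnormZ ger0_norm ?invr_ge0 ?ler0n//.
have h1 := hX (z.1 + z.2); have h2 := hY (z.1 - z.2).
have h3 := ler_wpM2l k0 (rnormD z.1 z.2).
have h4 := ler_wpM2l k0 (rnormD z.1 (- z.2)); rewrite rnormN in h4.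
have h5 := rnormD (X (z.1 + z.2)) (Y (z.1 - z.2)).
have h6 := rnormD (X (z.1 + z.2)) (- Y (z.1 - z.2)); rewrite rnormN in h6.
have h7 := ler_wpM2l k0 (rnorm_fst z); have h8 := ler_wpM2l k0 (rnorm_snd z).
lra.
Qed.

Fact mix_subproof X Y : mix_fun X Y \in @bounded_linear_pred R (hsum H).
Proof.
apply/mem_set; split.
  have linS c z w : X (c *: z.1 + w.1 + (c *: z.2 + w.2)) =
      c *: X (z.1 + z.2) + X (w.1 + w.2) by rewrite addrACA -scalerDr linearP.
  have linD c z w : Y (c *: z.1 + w.1 - (c *: z.2 + w.2)) =
      c *: Y (z.1 - z.2) + Y (w.1 - w.2) by rewrite opprD addrACA -scalerBr linearP.
  have halfP c u v u' v' : half *: (c *: u + v + (c *: u' + v')) =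
      c *: (half *: (u + u')) + half *: (v + v').
    by rewrite addrACA -scalerDr (scalerDr half (c *: _)) !scalerA (mulrC c).
  move=> c z w; rewrite /mix_fun /= linS linD; congr pair; rewrite /= -halfP //.
  by congr (_ *: _); rewrite opprD scalerN.
have [k1 k10 h1] := opnorm_bound X; have [k2 k20 h2] := opnorm_bound Y.
exists (4 * (k1 + k2)) => z; rewrite !rnormE -rmorphM lecR.
apply: mix_norm; first by rewrite addr_ge0 1?ltW.
  by apply: opnorm_leW h1; rewrite lerDl ltW.
by apply: opnorm_leW h2; rewrite lerDr ltW.
Qed.

Definition mix_op X Y : 'B(hsum H) := Bop (mix_subproof X Y).

(** Stated with the constant 4 of [opnorm_mix], so that both fit the single hypothesis [phi_norm]
    below. *)
Lemma opnorm_diag X Y k : 0 <= k -> opnorm_le X k -> opnorm_le Y k ->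
  opnorm_le (diag_op X Y) (4 * k).
Proof.
move=> k0 hX hY; apply/opnorm_leP => z; apply: (le_trans (diag_norm k0 hX hY z)).
by rewrite ler_wpM2r ?rnorm_ge0//; lra.
Qed.

Lemma opnorm_mix X Y k : 0 <= k -> opnorm_le X k -> opnorm_le Y k ->
  opnorm_le (mix_op X Y) (4 * k).
Proof. by move=> k0 hX hY; apply/opnorm_leP => z; exact: mix_norm. Qed.

Lemma diag_opD X Y X' Y' : diag_op (X + X') (Y + Y') = diag_op X Y + diag_op X' Y'.
Proof. exact: bop_eqP. Qed.

Lemma diag_opM X Y X' Y' : diag_op (X * X') (Y * Y') = diag_op X Y * diag_op X' Y'.
Proof. exact: bop_eqP. Qed.

Lemma diag_op_scalar (c : R) : diag_op (scalar_op c) (scalar_op c) = scalar_op c.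
Proof. exact: bop_eqP. Qed.

Lemma mix_opD X Y X' Y' : mix_op (X + X') (Y + Y') = mix_op X Y + mix_op X' Y'.
Proof.
apply: bop_eqP => z; congr pair; rewrite /= -scalerDr; congr (_ *: _).
  exact: addrACA.
by rewrite addrACA -opprD.
Qed.

(** In the coordinates z.1 + z.2 and z.1 - z.2 the operator acts diagonally by [X] and [Y];
    [half_sum] and [half_diff] recover these coordinates after the first factor has acted. *)
Lemma mix_opM X Y X' Y' : mix_op (X * X') (Y * Y') = mix_op X Y * mix_op X' Y'.
Proof.
by apply: bop_eqP => z; rewrite bopE /= /mix_fun /= half_sum half_diff.
Qed.

Lemma mix_op_scalar (c : R) : mix_op (scalar_op c) (scalar_op c) = scalar_op c.
Proof.
apply: bop_eqP => -[z1 z2].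
have halfP u v : half *: (c%:C *: u + c%:C *: v) = c%:C *: (half *: u + half *: v).
  by rewrite -scalerDr !scalerA mulrC -scalerA scalerDr.
have halfN u v : half *: (c%:C *: u - c%:C *: v) = c%:C *: (half *: u - half *: v).
  by rewrite -scalerN halfP scalerN.
congr pair; first exact: etrans (halfP _ _) (congr1 _ (half_sum _ _)).
exact: etrans (halfN _ _) (congr1 _ (half_diff _ _)).
Qed.

Lemma ip_diag X Y z : ip (diag_op X Y z) z = ip (X z.1) z.1 + ip (Y z.2) z.2.
Proof. by rewrite hsum_ip. Qed.

Lemma ip_mix X Y z : ip (mix_op X Y z) z =
  2^-1 * (ip (X (z.1 + z.2)) (z.1 + z.2) + ip (Y (z.1 - z.2)) (z.1 - z.2)).
Proof.
rewrite hsum_ip /= halfE !ipZl !(ipDl (X _)) (ipDr (X _)) (ipBr (Y _)) ipNl.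
by ring.
Qed.

Lemma self_adjoint_diag X Y : self_adjoint X -> self_adjoint Y -> self_adjoint (diag_op X Y).
Proof.
move=> /self_adjointP sX /self_adjointP sY; apply/self_adjointP => z w.
by rewrite !hsum_ip /= sX sY.
Qed.

Lemma self_adjoint_mix X Y : self_adjoint X -> self_adjoint Y -> self_adjoint (mix_op X Y).
Proof.
move=> /self_adjointP sX /self_adjointP sY; apply/self_adjointP => z w.
rewrite !hsum_ip /= halfE !ipZl !ipZr !(ipDl (X _)) !(ipDr _ (X _)) !ipNl !ipNr.
have := sX (z.1 + z.2) (w.1 + w.2); have := sY (z.1 - z.2) (w.1 - w.2).
rewrite !(linearD, linearB) /= !(ipDl, ipDr, ipNl, ipNr) => h1 h2.
lra.
Qed.

End HsumOperators.

(** * Operator concavity *)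

Section Transfer.
Context {R : realType} {H K : hilbertType R}.
Local Open Scope classical_set_scope.
Local Open Scope ring_scope.
(** Stands for [diag_op] and [mix_op]. A map on pairs that respects sums, products and real scalars
    commutes with real polynomials and, being bounded, with continuous functions. *)
Variable phi : 'B(H) -> 'B(H) -> 'B(K).
Hypothesis phiD : forall X Y X' Y', phi (X + X') (Y + Y') = phi X Y + phi X' Y'.
Hypothesis phiM : forall X Y X' Y', phi (X * X') (Y * Y') = phi X Y * phi X' Y'.
Hypothesis phi_scalar : forall c, phi (scalar_op c) (scalar_op c) = scalar_op c.
Hypothesis phi_norm : forall X Y k, 0 <= k -> opnorm_le X k -> opnorm_le Y k ->
  opnorm_le (phi X Y) (4 * k).

Lemma poly_op_transfer p X Y : poly_op p (phi X Y) = phi (poly_op p X) (poly_op p Y).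
Proof.
elim/poly_ind: p => [|p c IH]; first by rewrite -polyC0 !poly_opC phi_scalar.
by rewrite !(poly_opD, poly_opM, poly_opC, poly_opX) IH -phiM -phi_scalar -phiD.
Qed.

Lemma fun_calc_transfer (f : R -> R) a b X Y : a < b ->
  {within `[a, b], continuous f} ->
  scalar_op a ⪯ X -> X ⪯ scalar_op b -> scalar_op a ⪯ Y -> Y ⪯ scalar_op b ->
  scalar_op a ⪯ phi X Y -> phi X Y ⪯ scalar_op b ->
  fun_calc f (phi X Y) = phi (fun_calc f X) (fun_calc f Y).
Proof.
(* 12 is the 4 of [phi_norm] times the 3 of [fun_calc_approx]. *)
move=> ab fc aX Xb aY Yb aP Pb; apply: (fun_calc_eq ab aP Pb fc (k := 12)) => e e0.
have [p fp] := weierstrass ab fc e0; exists p => //.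
have hX := fun_calc_approx ab aX Xb fc e0 fp.
have hY := fun_calc_approx ab aY Yb fc e0 fp.
have -> : poly_op p (phi X Y) - phi (fun_calc f X) (fun_calc f Y) =
    phi (poly_op p X - fun_calc f X) (poly_op p Y - fun_calc f Y).
  by apply/eqP; rewrite subr_eq -phiD !subrK poly_op_transfer.
have e30 : 0 <= 3 * e by rewrite mulr_ge0// ltW.
by apply: opnorm_leW (phi_norm e30 hX hY); rewrite mulrA; lra.
Qed.

End Transfer.

(** * Continuity of the calculus under small scalar shifts *)

Section Shift.
Context {R : realType} {H : hilbertType R}.
Local Open Scope classical_set_scope.
Local Open Scope ring_scope.
Implicit Types (A : 'B(H)) (e : R).

Lemma opnorm_scalar e : 0 <= e -> opnorm_le (scalar_op e : 'B(H)) e.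
Proof. by move=> e0; apply/opnorm_leP => x; rewrite scalar_opE rnormZ ger0_norm. Qed.

Lemma poly_op_shift p A : exists2 C, 0 < C & forall e, 0 <= e <= 1 ->
  opnorm_le (poly_op p (A + scalar_op e) - poly_op p A) (C * e).
Proof.
elim/poly_ind: p => [|p c [C C0 IH]].
  exists 1 => // e /andP[e0 _]; rewrite -polyC0 !poly_opC subrr mul1r.
  exact: opnorm_le0.
have [k k0 hk] := opnorm_bound A; have [q q0 hq] := opnorm_bound (poly_op p A).
exists (C * (k + 1) + q) => [|e /andP[e0 e1]].
  by rewrite addr_gt0// mulr_gt0// addr_gt0.
rewrite !(poly_opD, poly_opM, poly_opC, poly_opX) opprD addrACA subrr addr0.
set B := A + scalar_op e.
have -> : poly_op p B * B - poly_op p A * A =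
    (poly_op p B - poly_op p A) * B + poly_op p A * scalar_op e.
  by rewrite mulrBl -addrA; congr (_ + _); rewrite /B mulrDr opprD addrNK.
have hB : opnorm_le B (k + 1).
  by apply: opnorm_leD => //; apply: opnorm_leW (opnorm_scalar e0).
have h1 := opnorm_leM (mulr_ge0 (ltW C0) e0) (IH e _) hB.
have := opnorm_leD (h1 _) (opnorm_leM (ltW q0) hq (opnorm_scalar e0)).
rewrite e0 e1 => /(_ isT); apply: opnorm_leW.
by rewrite le_eqVlt; apply/orP; left; apply/eqP; ring.
Qed.

Lemma scalar_le_shift a A e : 0 <= e -> scalar_op a ⪯ A -> scalar_op a ⪯ A + scalar_op e.
Proof.
move=> e0 aA; rewrite /loewner_le addrAC; apply: positive_opD => // x.
by rewrite scalar_opE hdotZl mulr_ge0 ?ler0c// -hdot_norm exprn_ge0.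
Qed.

Lemma shift_le_scalar b A e : A ⪯ scalar_op b -> A + scalar_op e ⪯ scalar_op (b + e).
Proof.
rewrite /loewner_le => Ab.
by rewrite /scalar_op rmorphD scalerDl opprD addrACA subrr addr0.
Qed.

Lemma loewner_scalar_le (a b : R) : a <= b -> (scalar_op a : 'B(H)) ⪯ scalar_op b.
Proof.
move=> ab; apply/scalar_leP => [|x]; first exact: self_adjoint_scalar.
by rewrite scalar_opE ipZl ipii ler_wpM2r// sqr_ge0.
Qed.

Lemma fun_calc_shift (f : R -> R) a b A : a < b ->
  {within `[a, b + 1], continuous f} -> scalar_op a ⪯ A -> A ⪯ scalar_op b ->
  forall e, 0 < e -> exists2 d, 0 < d <= 1 &
    opnorm_le (fun_calc f (A + scalar_op d) - fun_calc f A) e.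
Proof.
move=> ab fc aA Ab e e0.
have ab1 : a < b + 1 by rewrite ltr_wpDr.
have e90 : 0 < e / 9 by rewrite divr_gt0.
(* One polynomial on [a, b + 1] serves both A and A + d, as d <= 1. Each passage between f and p
   costs 3 (e / 9) = e / 3, and the shift of p costs C d <= e / 3. *)
have [p fp] := weierstrass ab1 fc e90; have [C C0 hC] := poly_op_shift p A.
pose d := Num.min 1 (e / (3 * C)).
have C30 : 0 < 3 * C by rewrite mulr_gt0.
have [d0 d1 dC] : [/\ 0 < d, d <= 1 & d * (3 * C) <= e].
  rewrite /d lt_min ltr01 divr_gt0// ge_min lexx; split => //.
  by rewrite -ler_pdivlMr// ge_min lexx orbT.
exists d; first by rewrite d0.
have Ab1 : A ⪯ scalar_op (b + 1).
  by apply: loewner_trans Ab _; apply: loewner_scalar_le; rewrite lerDl.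
have h1 := fun_calc_approx ab1 aA Ab1 fc e90 fp.
have aS := scalar_le_shift (ltW d0) aA.
have Sb : A + scalar_op d ⪯ scalar_op (b + 1).
  by apply: loewner_trans (shift_le_scalar d Ab) _; apply: loewner_scalar_le; rewrite lerD2l.
have h2 := fun_calc_approx ab1 aS Sb fc e90 fp.
have := hC d; rewrite (ltW d0) d1 => /(_ isT) h3.
apply: opnorm_leW (opnorm_le_dist (opnorm_le_dist (opnorm_leB h2) h3) h1).
lra.
Qed.

End Shift.

Section Concavity.
Context {R : realType}.
Local Open Scope classical_set_scope.
Local Open Scope ring_scope.
Implicit Types (f : R -> R).

(* Weaker than [operator_monotone]: with a scalar lower bound in place of
   [spectrum_pos] it passes from a decreasing [g] to its reciprocal. *)
Definition monotone_calculus f : Prop :=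
  forall (H : hilbertType R) (A B : 'B(H)) (a : R), 0 < a ->
    scalar_op a ⪯ A -> A ⪯ B -> fun_calc f A ⪯ fun_calc f B.

Lemma continuous_pos_itv f a b : 0 < a -> continuous_on_pos f ->
  {within `[a, b], continuous f}.
Proof.
move=> a0; apply: continuous_subspaceW => t /=; rewrite in_itv/= => /andP[at_ _].
exact: lt_le_trans at_.
Qed.

Lemma spectrum_pos_ge (H : hilbertType R) (A : 'B(H)) (a : R) : 0 < a ->
  scalar_op a ⪯ A -> spectrum_pos A.
Proof.
move=> a0 aA z; have [b _ [_ Ab]] := self_adjoint_bounds (loewner_self_adjoint aA).
move=> /(spectrum_bounds aA Ab)[t /andP[at_ _] ->].
by rewrite (_ : 0 = 0%:C)// ltcR (lt_le_trans a0).
Qed.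

Lemma operator_monotone_calculus f : operator_monotone f -> monotone_calculus f.
Proof.
move=> [_ fm] H A B a a0 aA AB; have aB := loewner_trans aA AB.
by apply: fm => //; do ?[exact: loewner_self_adjoint aA|exact: loewner_self_adjoint aB];
  [exact: spectrum_pos_ge aA|exact: spectrum_pos_ge aB].
Qed.

Lemma operator_concave f (H : hilbertType R) (X Y : 'B(H)) (a : R) :
  continuous_on_pos f -> monotone_calculus f ->
  0 < a -> scalar_op a ⪯ X -> scalar_op a ⪯ Y ->
  2^-1 *: (fun_calc f X + fun_calc f Y) ⪯ fun_calc f (2^-1 *: (X + Y)).
Proof.
move=> fc fm a0 aX aY.
have sX := loewner_self_adjoint aX; have sY := loewner_self_adjoint aY.
rewrite !half_real; set P := _ *: (X + Y); pose Q := (2^-1 : R)%:C *: (X - Y).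
have sP : self_adjoint P by apply/self_adjointZ/self_adjointD.
have sQ : self_adjoint Q by apply/self_adjointZ/self_adjointB.
have aP : scalar_op a ⪯ P.
  apply/scalar_leP => // x; rewrite /P !bopE ipZl ipDl.
  by have /(scalar_leP a sX)/(_ x) := aX; have /(scalar_leP a sY)/(_ x) := aY; lra.
have bound (T : 'B(H)) : scalar_op a ⪯ T ->
    exists2 b, a < b & forall c, b <= c -> T ⪯ scalar_op c.
  move=> aT; have [k k0 [_ Tk]] := self_adjoint_bounds (loewner_self_adjoint aT).
  exists (k + a); first by rewrite ltrDr.
  move=> c kc; apply: loewner_trans Tk _; apply: loewner_scalar_le.
  by rewrite (le_trans _ kc)// lerDl ltW.
have [b1 ab1 Xb1] := bound _ aX; have [b2 ab2 Yb2] := bound _ aY.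
have [b3 ab3 Pb3] := bound _ aP.
have sfc (T : 'B(H)) (c : R) : a < c -> scalar_op a ⪯ T -> T ⪯ scalar_op c ->
    self_adjoint (fun_calc f T).
  by move=> ac aT Tc; apply: self_adjoint_fun_calc ac aT Tc _ _; exact: continuous_pos_itv.
have sfX := sfc X b1 ab1 aX (Xb1 _ (lexx _)).
have sfY := sfc Y b2 ab2 aY (Yb2 _ (lexx _)).
have sfP := sfc P b3 ab3 aP (Pb3 _ (lexx _)).
apply: loewner_approx => //; first by apply/self_adjointZ/self_adjointD.
move=> e e0.
have [d /andP[d0 d1] hd] := fun_calc_shift ab3 (continuous_pos_itv a0 fc) aP
  (Pb3 _ (lexx _)) e0.
pose V := P + scalar_op d; pose W := P + d^-1%:C *: (Q * Q).
have aV : scalar_op a ⪯ V by exact: scalar_le_shift (ltW d0) aP.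
have aW : scalar_op a ⪯ W.
  rewrite /loewner_le /W addrAC; apply: positive_opD => //.
  by apply: positive_opZ (positive_sqr sQ); rewrite invr_ge0 ltW.
have [b4 ab4 Vb4] := bound _ aV; have [b5 ab5 Wb5] := bound _ aW.
have sV := loewner_self_adjoint aV; have sW := loewner_self_adjoint aW.
exists (fun_calc f V); last exact: hd.
split; first by apply: sfc ab4 aV _; exact: Vb4.
(* Each summand exceeds a > 0, so the sum dominates them all. It depends on [d], through the upper
   bound of [W]. *)
pose b := b1 + b2 + b4 + b5.
have [bb1 bb2 bb4 bb5] : [/\ b1 <= b, b2 <= b, b4 <= b & b5 <= b].
  by rewrite /b; split; lra.
have ab : a < b by exact: lt_le_trans bb1.
have sJ := self_adjoint_mix sX sY; have sD := self_adjoint_diag sV sW.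
(* The parallelogram law carries the scalar bounds of [X] and [Y] over to [mix_op X Y]. *)
have par (u v : H) : rnorm (u + v) ^+ 2 + rnorm (u - v) ^+ 2 = 2 * (rnorm u ^+ 2 + rnorm v ^+ 2).
  by rewrite rnormD_sqr rnormB_sqr; ring.
have aJ : scalar_op a ⪯ mix_op X Y.
  apply/scalar_leP => // z; rewrite ip_mix hsum_rnorm.
  have /(scalar_leP a sX)/(_ (z.1 + z.2)) := aX.
  have /(scalar_leP a sY)/(_ (z.1 - z.2)) := aY.
  have := congr1 ( *%R a) (par z.1 z.2); lra.
have Jb : mix_op X Y ⪯ scalar_op b.
  apply/le_scalarP => // z; rewrite ip_mix hsum_rnorm.
  have /(le_scalarP b sX)/(_ (z.1 + z.2)) := Xb1 _ bb1.
  have /(le_scalarP b sY)/(_ (z.1 - z.2)) := Yb2 _ bb2.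
  have := congr1 ( *%R b) (par z.1 z.2); lra.
have aD : scalar_op a ⪯ diag_op V W.
  apply/scalar_leP => // z; rewrite ip_diag hsum_rnorm.
  have /(scalar_leP a sV)/(_ z.1) := aV.
  have /(scalar_leP a sW)/(_ z.2) := aW; lra.
have Db : diag_op V W ⪯ scalar_op b.
  apply/le_scalarP => // z; rewrite ip_diag hsum_rnorm.
  have /(le_scalarP b sV)/(_ z.1) := Vb4 _ bb4.
  have /(le_scalarP b sW)/(_ z.2) := Wb5 _ bb5; lra.
(* The difference is [[d, - Q], [- Q, d^-1 Q^2]], a positive block matrix. *)
have JD : mix_op X Y ⪯ diag_op V W.
  have PE u v : ip (P u) v = 2^-1 * (ip (X u) v + ip (Y u) v) by rewrite !bopE ipZl ipDl.
  have QE u v : ip (Q u) v = 2^-1 * (ip (X u) v - ip (Y u) v) by rewrite !bopE ipZl ipBl.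
  clearbody P Q.
  have WE v : ip (W v) v = ip (P v) v + d^-1 * rnorm (Q v) ^+ 2.
    by rewrite bopDE bopZE bopME ipDl ipZl (self_adjointP Q).1// ipii.
  have VE u : ip (V u) u = ip (P u) u + d * rnorm u ^+ 2.
    by rewrite bopDE scalar_opE ipDl ipZl ipii.
  apply/loewner_leP => // -[u v]; rewrite ip_mix ip_diag /= VE WE !PE.
  have XC : ip (X v) u = ip (X u) v by rewrite ipC (self_adjointP X).1.
  have YC : ip (Y v) u = ip (Y u) v by rewrite ipC (self_adjointP Y).1.
  (* Completed square: this expression is exactly the difference of the two quadratic forms at (u,
     v). *)
  have := mulr_ge0 (ltW d0) (sqr_ge0 (rnorm (u - d^-1%:C *: Q v))).
  rewrite rnormB_sqr ipZr rnormZ ipC QE XC YC exprMn real_normK ?num_real//.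
  have -> : ip (X (u + v)) (u + v) = ip (X u) u + 2 * ip (X u) v + ip (X v) v.
    by rewrite (linearD X) /= !(ipDl, ipDr) XC; ring.
  have -> : ip (Y (u - v)) (u - v) = ip (Y u) u - 2 * ip (Y u) v + ip (Y v) v.
    by rewrite (linearB Y) /= !(ipBl, ipBr) YC; ring.
  have -> : d * (rnorm u ^+ 2 - 2 * (d^-1 * (2^-1 * (ip (X u) v - ip (Y u) v))) +
      d^-1 ^+ 2 * rnorm (Q v) ^+ 2) =
      d * rnorm u ^+ 2 - (ip (X u) v - ip (Y u) v) + d^-1 * rnorm (Q v) ^+ 2.
    by field; rewrite gt_eqF.
  by lra.
have fJ := fun_calc_transfer mix_opD mix_opM mix_op_scalar opnorm_mix ab
  (continuous_pos_itv a0 fc) aX (Xb1 _ bb1) aY (Yb2 _ bb2) aJ Jb.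
have fD := fun_calc_transfer diag_opD diag_opM diag_op_scalar opnorm_diag ab
  (continuous_pos_itv a0 fc) aV (Vb4 _ bb4) aW (Wb5 _ bb5) aD Db.
have := fm _ _ _ _ a0 aJ JD; rewrite fJ fD => fJD.
have sfV := sfc V b4 ab4 aV (Vb4 _ (lexx _)).
have sfW := sfc W b5 ab5 aW (Wb5 _ (lexx _)).
apply/loewner_leP => //; first by apply/self_adjointZ/self_adjointD.
(* At (u, 0) the left side is the form of (f(X) + f(Y)) / 2 and the right side that of f(V); [W]
   disappears. *)
move=> u; have h := (loewner_leP (self_adjoint_mix sfX sfY) (self_adjoint_diag sfV sfW)).1 fJD
  ((u, 0) : hsum H).
rewrite ip_mix ip_diag /= addr0 subr0 linear0 ipii rnorm0 expr0n/= addr0 in h.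
by rewrite bopZE bopDE ipZl ipDl.
Qed.

End Concavity.

(** * Operator means *)

Section Inverses.
Context {R : realType} {H : hilbertType R}.
Implicit Types (A B P Q S T D U V : 'B(H)).

Lemma is_inverse_sym A B : is_inverse A B -> is_inverse B A.
Proof. by case. Qed.

Lemma is_inverseM A A' B B' : is_inverse A A' -> is_inverse B B' ->
  is_inverse (A * B) (B' * A').
Proof.
move=> [h1 h2] [h3 h4]; split.
  by rewrite mulrA -[A * B * B']mulrA h3 mulr1.
by rewrite mulrA -[B' * A' * A]mulrA h2 mulr1.
Qed.

Lemma self_adjoint_inverse A B : self_adjoint A -> is_inverse A B -> self_adjoint B.
Proof.
move=> /self_adjointP sA [AB BA]; apply/self_adjointP => x y.
by rewrite -{1}[y]bop1E -{2}[x]bop1E -AB !bopME sA.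
Qed.

Lemma positive_inverse A B : positive_op A -> is_inverse A B -> positive_op B.
Proof.
move=> pA AB; have sB := self_adjoint_inverse (positive_self_adjoint pA) AB.
by rewrite -[B]mulr1 -AB.1 mulrA; exact: positive_conj.
Qed.

Lemma loewner_positive A B : positive_op A -> A ⪯ B -> positive_op B.
Proof. by move=> pA AB; rewrite -(subrK A B); exact: positive_opD. Qed.

(** U' - V' = (U' - V') U (U' - V') + V' (V - U) V', a sum of two positive conjugations; no square
    root is involved. *)
Lemma inverse_antitone U U' V V' : positive_op U -> U ⪯ V ->
  is_inverse U U' -> is_inverse V V' -> V' ⪯ U'.
Proof.
move=> pU UV iU iV; have pV := loewner_positive pU UV.
have sU := self_adjoint_inverse (positive_self_adjoint pU) iU.
have sV := self_adjoint_inverse (positive_self_adjoint pV) iV.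
have [UU' U'U] := iU; have [VV' V'V] := iV.
rewrite /loewner_le.
have -> : U' - V' = (U' - V') * U * (U' - V') + V' * (V - U) * V'.
  have -> : (U' - V') * U * (U' - V') = U' - V' - (V' - V' * U * V').
    by rewrite mulrBl U'U mulrBl mul1r mulrBr -[V' * U * U']mulrA UU' mulr1.
  by rewrite mulrBr V'V mulrBl mul1r subrK.
by apply: positive_opD; apply: positive_conj => //; exact: self_adjointB.
Qed.

Lemma scalar_is_inverse (k : R) : k != 0 ->
  is_inverse (scalar_op k : 'B(H)) (scalar_op k^-1).
Proof.
by move=> k0; split; rewrite bopZAl mul1r scalerA -rmorphM ?mulfV ?mulVf// scale1r.
Qed.

(** The inverse is bounded above by some scalar k, and inverting that inequality gives the lower
    bound 1 / k. *)
Lemma strictly_positive_ge A : strictly_positive_op A ->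
  exists2 e : R, 0 < e & scalar_op e ⪯ A.
Proof.
move=> [pA [B AB]]; have pB := positive_inverse pA AB.
have [k k0 [_ Bk]] := self_adjoint_bounds (positive_self_adjoint pB).
exists k^-1; first by rewrite invr_gt0.
apply: inverse_antitone pB Bk (is_inverse_sym AB) _.
by apply: scalar_is_inverse; rewrite gt_eqF.
Qed.

Lemma ge_strictly_positive (e : R) A : 0 < e -> scalar_op e ⪯ A -> strictly_positive_op A.
Proof.
move=> e0 eA; have sA := loewner_self_adjoint eA; have /(scalar_leP e sA) h := eA.
split; last exact: coercive_invertible e0 h.
apply/positive_opP; split => // x; apply: le_trans (h x).
by rewrite mulr_ge0 ?sqr_ge0// ltW.
Qed.

Lemma strictly_positive_mean A B : strictly_positive_op A -> positive_op B ->
  strictly_positive_op (2^-1 *: (A + B)).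
Proof.
move=> spA pB; have [e e0 eA] := strictly_positive_ge spA.
apply: (@ge_strictly_positive (2^-1 * e)); first by rewrite mulr_gt0 ?invr_gt0.
rewrite half_real /loewner_le /scalar_op rmorphM -scalerA -scalerBr.
apply: positive_opZ; first by rewrite invr_ge0.
by rewrite addrAC; apply: positive_opD.
Qed.

Lemma sqrt_op_spec P : positive_op P ->
  positive_op (sqrt_op P) /\ sqrt_op P * sqrt_op P = P.
Proof.
move=> pP; have [b b0 [_ Pb]] := self_adjoint_bounds (positive_self_adjoint pP).
have P0 : scalar_op 0 ⪯ P by rewrite /loewner_le /scalar_op scale0r subr0.
have sc : ({within `[0%R, b], continuous (@Num.sqrt R)})%classic.
  by apply: continuous_subspaceT; exact: sqrt_continuous.
have ic : ({within `[0%R, b], continuous (@id R)})%classic.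
  by apply: continuous_subspaceT => t; exact: cvg_id.
split; first by apply: (positive_fun_calc b0 P0 Pb sc) => t _; exact: sqrtr_ge0.
rewrite /sqrt_op -(fun_calcM b0 P0 Pb sc sc) -[RHS](fun_calc_id b0 P0 Pb).
apply: (eq_in_fun_calc b0 P0 Pb) => //; first exact: within_continuousM.
by move=> t /andP[t0 _]; rewrite -expr2 sqr_sqrtr.
Qed.

Lemma mean_sub_conj S D P Q : S * S = P -> S * D * D * S = Q ->
  2^-1 *: (P + Q) - S * D * S = 2^-1 *: (S * ((1 - D) * (1 - D)) * S).
Proof.
move=> <- <-; have -> : S * D * S = 2^-1 *: (S * D * S + S * D * S).
  by rewrite scalerDr -scalerDl -div1r -splitr scale1r.
rewrite -scalerBr; congr (_ *: _).
have -> : (1 - D) * (1 - D) = 1 - D - (D - D * D).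
  by rewrite mulrBl mul1r mulrBr mulr1.
by rewrite !mulrBr !mulrBl mulr1 !mulrA opprB [RHS]addrACA opprD.
Qed.

Lemma conj_le_mean S D P Q : self_adjoint S -> self_adjoint D ->
  S * S = P -> S * D * D * S = Q -> S * D * S ⪯ 2^-1 *: (P + Q).
Proof.
move=> sS sD SP SQ; rewrite /loewner_le (mean_sub_conj SP SQ) half_real.
apply: positive_opZ; first by rewrite invr_ge0.
by apply: positive_conj => //; apply: positive_sqr; exact: self_adjointB.
Qed.

(* [A ♯ B = S D S] where [S] and [D] are the square roots of [A] and [S^-1 B S^-1]. *)
Lemma geometric_mean_factor A B : strictly_positive_op A -> positive_op B ->
  exists S D, [/\ positive_op S, positive_op D, invertible_op S,
    A ♯ B = S * D * S & S * S = A /\ S * D * D * S = B].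
Proof.
move=> [pA iA] pB; have [pS SA] := sqrt_op_spec pA.
have iS : invertible_op (sqrt_op A) by apply: (invertible_mulI (B := sqrt_op A)); rewrite ?SA.
have [ST TS] := invertible_inv iS.
have sT := self_adjoint_inverse (positive_self_adjoint pS) (conj ST TS).
have := sqrt_op_spec (positive_conj sT pB).
rewrite /geometric_mean; move: (sqrt_op A) (inv_op _) pS SA iS ST TS sT => S T pS SA iS ST TS sT.
move: (sqrt_op _) => D [pD DB]; exists S, D; split => //; split => //.
by rewrite -[S * D * D]mulrA DB !mulrA ST mul1r -mulrA TS mulr1.
Qed.

Lemma geometric_le_arithmetic A B : strictly_positive_op A -> strictly_positive_op B ->
  A ♯ B ⪯ 2^-1 *: (A + B).
Proof.
move=> spA [pB _]; have [S [D [pS pD iS -> [SA SB]]]] := geometric_mean_factor spA pB.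
by apply: conj_le_mean => //; exact: positive_self_adjoint.
Qed.

(** The arithmetic-geometric inequality for the inverses, inverted: with T and D' inverse to S and
    D, T T = A^-1 and T D' D' T = B^-1, while T D' T is the inverse of S D S. *)
Lemma harmonic_le_geometric A B : strictly_positive_op A -> strictly_positive_op B ->
  inv_op (2^-1 *: (inv_op A + inv_op B)) ⪯ A ♯ B.
Proof.
move=> spA spB; have [pA iA] := spA; have [pB iB] := spB.
have [S [D [pS pD iS -> [SA SB]]]] := geometric_mean_factor spA pB.
have invA := invertible_inv iA; have invB := invertible_inv iB.
have invS := invertible_inv iS; have [ST TS] := invS; set T := inv_op S in ST TS invS.
(* [D * D] is the product T B T of invertible operators, and [D] commutes with itself. *)
have iD : invertible_op D.
  apply: (invertible_mulI (B := D)) => //.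
  have -> : D * D = T * B * T.
    by rewrite -SB !mulrA TS mul1r -!mulrA ST mulr1.
  by do 2?[apply: invertible_mul => //]; exists S; exact: is_inverse_sym.
have invD := invertible_inv iD; set D' := inv_op D in invD.
have sT := self_adjoint_inverse (positive_self_adjoint pS) invS.
have sD' := self_adjoint_inverse (positive_self_adjoint pD) invD.
have TA : T * T = inv_op A.
  by apply/esym/is_inverse_inv; rewrite -SA; exact: is_inverseM.
have TB : T * D' * D' * T = inv_op B.
  apply/esym/is_inverse_inv; rewrite -SB -[T * D' * D' * T]mulrA -[T * D' * _]mulrA.
  exact: is_inverseM (is_inverseM (is_inverseM invS invD) invD) invS.
have invG : is_inverse (T * D' * T) (S * D * S).
  rewrite -[S * D * S]mulrA.
  have invT := is_inverse_sym invS.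
  exact: is_inverseM (is_inverseM invT (is_inverse_sym invD)) invT.
have pG : positive_op (T * D' * T).
  exact: positive_conj sT (positive_inverse pD invD).
apply: inverse_antitone pG (conj_le_mean sT sD' TA TB) invG _.
apply: invertible_inv.
have spA' : strictly_positive_op (inv_op A).
  by split; [exact: positive_inverse pA invA|exists A; exact: is_inverse_sym].
exact: (strictly_positive_mean spA' (positive_inverse pB invB)).2.
Qed.

End Inverses.

(** * Reciprocals of positive decreasing functions *)

Section Reciprocal.
Context {R : realType}.
Implicit Types (g : R -> R) (a b : R).

Definition antitone_calculus g : Prop :=
  forall (H : hilbertType R) (A B : 'B(H)) (a : R), 0 < a ->
    scalar_op a ⪯ A -> A ⪯ B -> fun_calc g B ⪯ fun_calc g A.

Lemma operator_monotone_decreasing_calculus g :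
  operator_monotone_decreasing g -> antitone_calculus g.
Proof.
move=> [_ gm] H A B a a0 aA AB; have aB := loewner_trans aA AB.
by apply: gm => //; do ?[exact: loewner_self_adjoint aA|exact: loewner_self_adjoint aB];
  [exact: spectrum_pos_ge aA|exact: spectrum_pos_ge aB].
Qed.

Section PositiveFunction.
Variable g : R -> R.
Hypotheses (gc : continuous_on_pos g) (g0 : forall t, 0 < t -> 0 < g t).

Local Notation gV := (fun t => (g t)^-1).

Lemma continuous_on_posV : continuous_on_pos gV.
Proof.
apply/subspace_continuousP => t t0; apply: cvgV; first by rewrite gt_eqF// g0.
by move/subspace_continuousP : gc; apply.
Qed.

(** Multiplicativity of the calculus applied to g (1 / g) = 1 on [a, a + k], where g is positive. *)
Lemma fun_calcV (H : hilbertType R) (A : 'B(H)) a : 0 < a -> scalar_op a ⪯ A ->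
  positive_op (fun_calc g A) /\ is_inverse (fun_calc g A) (fun_calc gV A).
Proof.
move=> a0 aA; have [k k0 [_ Ak]] := self_adjoint_bounds (loewner_self_adjoint aA).
have ab : a < a + k by rewrite ltrDl.
have Ab : A ⪯ scalar_op (a + k).
  by apply: loewner_trans Ak _; apply: loewner_scalar_le; rewrite lerDr ltW.
have gi := continuous_pos_itv (b := a + k) a0 gc.
have gVi := continuous_pos_itv (b := a + k) a0 continuous_on_posV.
have pos t : a <= t <= a + k -> 0 < t by move=> /andP[at_ _]; exact: lt_le_trans at_.
split; first by apply: (positive_fun_calc ab aA Ab gi) => t /pos /g0 /ltW.
have one : fun_calc (fun=> 1) A = 1.
  by rewrite (fun_calc_cst ab aA Ab) /scalar_op scale1r.
have c1 : ({within `[a, a + k], continuous (fun=> 1 : R)})%classic.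
  exact/continuous_subspaceT/cst_continuous.
split; rewrite -one -(fun_calcM ab aA Ab) //; apply: (eq_in_fun_calc ab aA Ab) => //;
  do ?exact: within_continuousM; move=> t /pos /g0 gt0.
  by rewrite mulfV// gt_eqF.
by rewrite mulVf// gt_eqF.
Qed.

Lemma monotone_calculusV : antitone_calculus g -> monotone_calculus gV.
Proof.
move=> gm H A B a a0 aA AB; have aB := loewner_trans aA AB.
have [pA iA] := fun_calcV a0 aA; have [pB iB] := fun_calcV a0 aB.
exact: inverse_antitone pB (gm _ _ _ _ a0 aA AB) iB iA.
Qed.

Lemma fun_calc_le_harmonic (H : hilbertType R) (X Y : 'B(H)) a :
  antitone_calculus g -> 0 < a -> scalar_op a ⪯ X -> scalar_op a ⪯ Y ->
  scalar_op a ⪯ 2^-1 *: (X + Y) ->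
  fun_calc g (2^-1 *: (X + Y)) ⪯
    inv_op (2^-1 *: (inv_op (fun_calc g X) + inv_op (fun_calc g Y))).
Proof.
move=> gm a0 aX aY aP.
have [pX iX] := fun_calcV a0 aX; have [pY iY] := fun_calcV a0 aY.
have [pP iP] := fun_calcV a0 aP.
rewrite (is_inverse_inv iX) (is_inverse_inv iY).
have spX : strictly_positive_op (fun_calc gV X).
  by split; [exact: positive_inverse pX iX|exists (fun_calc g X); exact: is_inverse_sym].
have [pU iU] := strictly_positive_mean spX (positive_inverse pY iY).
apply: inverse_antitone pU _ (invertible_inv iU) (is_inverse_sym iP).
exact: operator_concave continuous_on_posV (monotone_calculusV gm) a0 aX aY.
Qed.

End PositiveFunction.
End Reciprocal.

(** * The Kantorovich bound *)

Section Kantorovich.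
Context {R : realType} {H : hilbertType R}.
Variables (A : 'B(H)) (m M : R).
Hypotheses (m_gt0 : 0 < m) (m_lt_M : m < M).
Hypotheses (mI_le_A : scalar_op m ⪯ A) (A_le_MI : A ⪯ scalar_op M).

(** [poly_op p A] is the value of the continuous calculus at [horner p], which [p] approximates with
    no error. *)
Lemma positive_poly_op (p : {poly R}) :
  (forall t, m <= t <= M -> 0 <= p.[t]) -> positive_op (poly_op p A).
Proof.
have pc : ({within `[m, M], continuous (horner p)})%classic.
  exact/continuous_subspaceT/continuous_horner.
rewrite -[poly_op p A](@fun_calc_eq _ _ m M A m_lt_M mI_le_A A_le_MI (horner p) _ 0 pc).
  exact: positive_fun_calc m_lt_M mI_le_A A_le_MI _ pc.
move=> e e0; exists p => [t _|]; first by rewrite subrr normr0 ltW.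
by rewrite subrr mul0r; exact: opnorm_le0.
Qed.

Lemma kantorovich_inverse : is_inverse A (inv_op A) ->
  ((M * m)^-1)%:C *: A + inv_op A ⪯ scalar_op ((M + m) / (M * m)).
Proof.
move=> [AB BA]; set B := inv_op A in AB BA *.
have sA := loewner_self_adjoint mI_le_A.
have sB := self_adjoint_inverse sA (conj AB BA).
have M_gt0 : 0 < M by exact: lt_trans m_lt_M.
(* The extra factor 'X makes the two-sided product [B * poly_op p A * B] equal to A^-1 (A - m)(M -
   A), so positivity follows from conjugation by the self-adjoint [B]. *)
pose p : {poly R} := 'X * ('X - m%:P) * (M%:P - 'X).
have pp : positive_op (poly_op p A).
  apply: positive_poly_op => t /andP[mt tM]; rewrite !hornerE.
  by rewrite !mulr_ge0 ?subr_ge0// (le_trans _ mt)// ltW.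
have pE : B * poly_op p A * B = scalar_op (M + m) - A - (M * m)%:C *: B.
  rewrite !(poly_opM, poly_opB, poly_opC, poly_opX).
  rewrite !mulrA BA mul1r -mulrA [(_ - A) * B]mulrBl AB.
  have -> : scalar_op M * B = M%:C *: B by rewrite bopZAl mul1r.
  rewrite mulrBl !mulrBr !mulr1 bopZAr AB.
  have -> : scalar_op m * (M%:C *: B) = (M * m)%:C *: B.
    by rewrite bopZAl mul1r scalerA -rmorphM mulrC.
  rewrite -/(scalar_op M) /scalar_op rmorphD scalerDl.
  by rewrite opprB addrACA [in RHS]addrAC -[RHS]addrA; congr (_ + _); rewrite addrC.
rewrite /loewner_le.
have -> : scalar_op ((M + m) / (M * m)) - ((((M * m)^-1)%:C *: A) + B) =
    ((M * m)^-1)%:C *: (B * poly_op p A * B).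
  rewrite pE !scalerBr !scalerA -!rmorphM mulVf ?mulf_neq0 ?gt_eqF// scale1r.
  by rewrite opprD addrA [(M + m) / _]mulrC.
by apply: positive_opZ; [rewrite invr_ge0 mulr_ge0// ltW|exact: positive_conj].
Qed.

End Kantorovich.

(** * The two chains of inequalities *)

Lemma positive_map_le (R : realType) (H : hilbertType R)
    (Phi : {linear 'B(H) -> 'B(H)}) (A B : 'B(H)) :
  positive_map Phi -> A ⪯ B -> Phi A ⪯ Phi B.
Proof. by move=> pPhi AB; rewrite /loewner_le -linearB; exact: pPhi. Qed.

Lemma unital_map_scalar (R : realType) (H : hilbertType R)
    (Phi : {linear 'B(H) -> 'B(H)}) (r : R) :
  Phi 1 = 1 -> Phi (scalar_op r) = scalar_op r.
Proof. by move=> Phi1; rewrite linearZ /= Phi1. Qed.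

Lemma scale_scalar_op (R : realType) (H : hilbertType R) (r s : R) :
  r%:C *: (scalar_op s : 'B(H)) = scalar_op (r * s).
Proof. by rewrite scalerA -rmorphM. Qed.

Lemma loewner_scale (R : realType) (H : hilbertType R) (A B : 'B(H)) (r : R) :
  0 <= r -> A ⪯ B -> r%:C *: A ⪯ r%:C *: B.
Proof. by move=> r0 AB; rewrite /loewner_le -scalerBr; exact: positive_opZ. Qed.

Theorem corollary2p2 (R : realType) (H : hilbertType R) (A : 'B(H)) (m M : R)
    (Phi : {linear 'B(H) -> 'B(H)})
    (A_positive : positive_op A) (m_gt0 : 0 < m) (m_lt_M : m < M)
    (mI_le_A : scalar_op m ⪯ A) (A_le_MI : A ⪯ scalar_op M)
    (Phi_positive : positive_map Phi) (Phi_normalized : Phi 1 = 1) :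
  let c : R := (M + m) / (2 * M * m) in
  let X : 'B(H) := ((M * m)^-1)%:C *: Phi A in
  let Y : 'B(H) := Phi (inv_op A) in
  (forall f : R -> R, operator_monotone f ->
    let fX := fun_calc f X in
    let fY := fun_calc f Y in
    [/\ fun_calc f (2^-1 *: (X + Y)) ⪯ scalar_op (f c),
        2^-1 *: (fX + fY) ⪯ fun_calc f (2^-1 *: (X + Y))
      & strictly_positive_op fX -> strictly_positive_op fY ->
        fX ♯ fY ⪯ 2^-1 *: (fX + fY)])
  /\
  (forall g : R -> R, operator_monotone_decreasing g ->
    let gX := fun_calc g X in
    let gY := fun_calc g Y in
    let harmonic := inv_op (2^-1 *: (inv_op gX + inv_op gY)) in
    [/\ scalar_op (g c) ⪯ fun_calc g (2^-1 *: (X + Y)),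
        (forall t : R, 0 < t -> 0 < g t) ->
        fun_calc g (2^-1 *: (X + Y)) ⪯ harmonic
      & strictly_positive_op gX -> strictly_positive_op gY ->
        harmonic ⪯ gX ♯ gY]).
Proof.
move=> c X Y.
have M_gt0 : 0 < M by exact: lt_trans m_lt_M.
have [_ /invertible_inv iA] := ge_strictly_positive m_gt0 mI_le_A.
have MV : 0 < M^-1 by rewrite invr_gt0.
have Mm : 0 < (M * m)^-1 by rewrite invr_gt0 mulr_gt0.
(* 1 / M bounds both arguments from below: m / (M m) = 1 / M for [X], and A <= M inverted for [Y].
   It is the scalar lower bound for every use of the calculus here. *)
have MX : scalar_op M^-1 ⪯ X.
  have := loewner_scale (ltW Mm) (positive_map_le Phi_positive mI_le_A).
  rewrite unital_map_scalar// scale_scalar_op (_ : (M * m)^-1 * m = M^-1)//.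
  by field; rewrite !gt_eqF.
have MY : scalar_op M^-1 ⪯ Y.
  have MiA := inverse_antitone A_positive A_le_MI iA (scalar_is_inverse (lt0r_neq0 M_gt0)).
  by have := positive_map_le Phi_positive MiA; rewrite unital_map_scalar.
have MP : scalar_op M^-1 ⪯ 2^-1 *: (X + Y).
  rewrite half_real; have -> : scalar_op M^-1 =
      (2^-1 : R)%:C *: (scalar_op M^-1 + scalar_op M^-1) :> 'B(H).
    by rewrite -scalerDl -rmorphD scale_scalar_op; congr scalar_op; field; rewrite gt_eqF.
  apply: loewner_scale; first by rewrite invr_ge0.
  by rewrite /loewner_le opprD addrACA; apply: positive_opD.
have Pc : 2^-1 *: (X + Y) ⪯ scalar_op c.
  have -> : scalar_op c = 2^-1 *: (scalar_op ((M + m) / (M * m)) : 'B(H)).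
    by rewrite half_real scale_scalar_op; congr scalar_op; rewrite /c; field; rewrite !gt_eqF.
  rewrite half_real; apply: loewner_scale; first by rewrite invr_ge0.
  have := positive_map_le Phi_positive (kantorovich_inverse m_gt0 m_lt_M mI_le_A A_le_MI iA).
  by rewrite unital_map_scalar// linearD linearZ.
split=> [f fm fX fY|g gm gX gY harmonic].
- have fm' := operator_monotone_calculus fm; have [fc _] := fm.
  split; last exact: geometric_le_arithmetic.
    (* The scalar f(c) is the value of [f] at the scalar operator [c], so this is monotonicity
       applied to [Pc]. *)
    by rewrite -fun_calc_scalar; apply: fm' MP Pc.
  exact: operator_concave fc fm' MV MX MY.
- have gm' := operator_monotone_decreasing_calculus gm; have [gc _] := gm.
  split; last exact: harmonic_le_geometric.
    by rewrite -fun_calc_scalar; apply: gm' MP Pc.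
  by move=> g0; exact: (fun_calc_le_harmonic gc g0 gm' MV MX MY MP).
Qed.
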